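(* Let $n,d,K\in\mathbb{N}$ and let $f=\frac1n\sum_{i=1}^n f_i$, where each $f_i:\mathbb{R}^d\to\mathbb{R}$ is differentiable. Assume: (i) there exists $\mathbf{x}_\star\in\mathbb{R}^d$ such that $f_\star:=f(\mathbf{x}_\star)=\inf_{\mathbf{x}\in\mathbb{R}^d}f(\mathbf{x})\in\mathbb{R}$; (ii) each $f_i$ is convex; (iii) each $f_i$ is $L_i$-smooth for some $L_i>0$. Suppose Random Reshuffling is employed. Then, with the optimally tuned constant stepsize $\eta_k=\eta_\star$ for all $k\in\{1,\dots,K\}$, where $\eta_\star\le\frac{1}{6\hat L}$, Shuffling SGD started from $\mathbf{x}_1^1\in\mathbb{R}^d$ and run for $K$ epochs guarantees that $$\mathbb{E}\left[f(\bar{\mathbf{x}}_K)-f_\star\right]\lesssim\frac{\hat L\|\mathbf{x}_1^1-\mathbf{x}_\star\|^2}{nK}+\min\left\{\frac{\sigma_\star\|\mathbf{x}_1^1-\mathbf{x}_\star\|}{\sqrt{nK}},\ \left(\frac{\bar L\sigma_\star^2\|\mathbf{x}_1^1-\mathbf{x}_\star\|^4}{nK^2}\right)^{\frac13}\right\},$$ where $\bar{\mathbf{x}}_K:=\sum_{k=1}^K\sum_{i=1}^n\frac{\eta_k}{nH_K}\mathbf{x}_k^i$ and $H_K:=\sum_{k=1}^K\eta_k$.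
   Context: $\|\cdot\|$ is the Euclidean norm on $\mathbb{R}^d$. A differentiable $h:\mathbb{R}^d\to\mathbb{R}$ is $L$-smooth if $\|\nabla h(\mathbf{x})-\nabla h(\mathbf{y})\|\le L\|\mathbf{x}-\mathbf{y}\|$ for all $\mathbf{x},\mathbf{y}\in\mathbb{R}^d$. Notation: $\bar L:=\frac1n\sum_{i=1}^nL_i$, $\hat L:=\max_{1\le i\le n}L_i$, $\sigma_\star^2:=\frac1n\sum_{i=1}^n\|\nabla f_i(\mathbf{x}_\star)\|^2$ with $\sigma_\star\ge 0$. The symbol $\lesssim$ means inequality up to an absolute multiplicative constant. Shuffling SGD: given an initial point $\mathbf{x}_1^1\in\mathbb{R}^d$ and stepsizes $\eta_k>0$, for each epoch $k=1,\dots,K$ generate a permutation $\pi_k=(\pi_k^1,\dots,\pi_k^n)$ of $\{1,\dots,n\}$, set $\mathbf{x}_k^{i+1}=\mathbf{x}_k^i-\eta_k\nabla f_{\pi_k^i}(\mathbf{x}_k^i)$ for $i=1,\dots,n$, and then $\mathbf{x}_{k+1}^1=\mathbf{x}_k^{n+1}$. Random Reshuffling: each $\pi_k$ is drawn independently and uniformly from the set of all permutations of $\{1,\dots,n\}$. $\mathbb{E}$ denotes expectation over these permutations. ''Optimally tuned'' means that the constant stepsize $\eta$ is chosen by optimizing, over $0<\eta\le\frac{1}{6\hat L}$, the upper bound $\frac{6\|\mathbf{x}_1^1-\mathbf{x}_\star\|^2}{\eta nK}+51\min\{\eta,\eta^2n\bar L\}\sigma_\star^2$ on $\mathbb{E}[f(\bar{\mathbf{x}}_K)-f_\star]$,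 which holds for every such constant stepsize; thus $\eta_\star$ may depend on the problem parameters, on $\mathbf{x}_1^1$ and on $K$. *)

(* Defs.v *)
From HB Require Import structures.
From mathcomp Require Export all_boot all_order all_algebra all_fingroup.
From mathcomp Require Export all_classical all_reals all_analysis.
Export Order.TTheory GRing.Theory Num.Theory.
Export numFieldNormedType.Exports.

Set Implicit Arguments.
Unset Strict Implicit.
Unset Printing Implicit Defensive.

Local Open Scope classical_set_scope.
Local Open Scope ring_scope.

(* The canonical norm of 'rV[R]_d is the sup norm, hence a separate Euclidean
   norm.  Both norms induce the same topology, so [differentiable] below is
   Frechet differentiability for the Euclidean norm as well. *)
Definition enorm (R : realType) (d : nat) (v : 'rV[R]_d) : R :=
  Num.sqrt (\sum_(j < d) v ord0 j ^+ 2).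

Definition gradient (R : realType) (d : nat) (h : 'rV[R]_d -> R)
    (x : 'rV[R]_d) : 'rV[R]_d :=
  \row_(j < d) 'D_(delta_mx ord0 j) h x.

Definition smooth (R : realType) (d : nat) (L : R) (h : 'rV[R]_d -> R) : Prop :=
  (forall x, differentiable h x) /\
  (forall x y, enorm (gradient h x - gradient h y) <= L * enorm (x - y)).

Definition favg (R : realType) (d n : nat) (f : 'I_n -> 'rV[R]_d -> R)
    (x : 'rV[R]_d) : R :=
  n%:R^-1 * \sum_(i < n) f i x.

Definition Lbar (R : realType) (n : nat) (L : 'I_n -> R) : R :=
  n%:R^-1 * \sum_(i < n) L i.

(* The default value 0 is harmless: this is used with n > 0 and L i > 0. *)
Definition Lhat (R : realType) (n : nat) (L : 'I_n -> R) : R :=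
  \big[Num.max/0]_(i < n) L i.

Definition sigma_star (R : realType) (d n : nat) (f : 'I_n -> 'rV[R]_d -> R)
    (xstar : 'rV[R]_d) : R :=
  Num.sqrt (n%:R^-1 * \sum_(i < n) enorm (gradient (f i) xstar) ^+ 2).

(* Indices start at 0: [x k i] is the iterate reached after k full epochs and
   i further steps, so the trajectory starts at [x 0 0] and the (k+1)-st epoch
   runs through x k 0, ..., x k n = x k.+1 0. *)
Definition shuffling_sgd (R : realType) (d n K : nat)
    (f : 'I_n -> 'rV[R]_d -> R) (eta : 'I_K -> R) (pi : 'I_K -> 'S_n)
    (x1 : 'rV[R]_d) (x : nat -> nat -> 'rV[R]_d) : Prop :=
  [/\ x 0%N 0%N = x1,
      forall (k : 'I_K) (i : 'I_n),
        x k i.+1 = x k i - eta k *: gradient (f (pi k i)) (x k i)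
    & forall k : 'I_K, x k.+1 0%N = x k n].

Definition averaged_iterate (R : realType) (d n K : nat) (eta : 'I_K -> R)
    (x : nat -> nat -> 'rV[R]_d) : 'rV[R]_d :=
  let H := \sum_(k < K) eta k in
  \sum_(k < K) \sum_(i < n) (eta k / (n%:R * H)) *: x k i.

(* Mutual independence of a finite family of random elements of a finite type,
   on which every subset is an event. *)
Definition mutually_independent (disp : measure_display)
    (T : measurableType disp) (R : realType) (P : probability T R)
    (I S : finType) (X : I -> T -> S) : Prop :=
  forall (J : {set I}) (A : I -> {set S}),
    P [set w | forall i, i \in J -> X i w \in A i] =
    (\prod_(i in J) P [set w | X i w \in A i])%E.

Definition random_reshuffling (disp : measure_display)
    (T : measurableType disp) (R : realType) (P : probability T R)
    (n K : nat) (pi : 'I_K -> T -> 'S_n) : Prop :=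
  [/\ forall k s, measurable [set w | pi k w = s],
      mutually_independent P pi
    & forall k s, P [set w | pi k w = s] = (#|{perm 'I_n}|%:R^-1)%:E].

(* Upper bound on the expected suboptimality with constant stepsize eta that
   the tuning minimizes; here D is the distance from the initial point to the
   minimizer. *)
Definition rr_bound (R : realType) (n K : nat) (D Lb sigma eta : R) : R :=
  6 * D ^+ 2 / (eta * n%:R * K%:R) +
  51 * Num.min eta (eta ^+ 2 * n%:R * Lb) * sigma ^+ 2.

Definition optimally_tuned (R : realType) (n K : nat) (D Lb Lh sigma eta : R)
    : Prop :=
  [/\ 0 < eta, eta <= 1 / (6 * Lh)
    & forall e, 0 < e -> e <= 1 / (6 * Lh) ->
        rr_bound n K D Lb sigma eta <= rr_bound n K D Lb sigma e].

(* Main.v *)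
From mathcomp Require Import ring lra measurable_realfun.
Require Import Defs.

(** Two one-epoch estimates are averaged over the epochs, using that each epoch
    permutation is independent of the point where the epoch starts.

    For every stepsize [eta <= 1 / (6 Lhat)], gradient steps are nonexpansive, so
    transposing two entries of a permutation moves the iterates by at most [eta]
    times a difference of two gradients.  Transpositions preserve the uniform
    law; hence the component sampled without replacement can be exchanged for
    any other one at a cost of order [eta], which yields noise [eta sigma^2] as
    for SGD with replacement.

    If moreover [eta n Lbar <= 1/4], the whole epoch is compared with one full
    gradient step from its starting point.  Cocoercivity of the gradients absorbs
    the deviations, and the drift is governed by
    [E (L_(pi i) |sum_(j < i) grad f_(pi j) xstar|^2) <= 2 n Lbar sigma^2], which
    holds because the gradients sum to zero at [xstar].  The noise is then
    [eta^2 n Lbar sigma^2].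

    Together these give twice the bound that the stepsize minimizes.  Comparing
    the minimum with the value at a capped stepsize [D^2 / (n K t)], where [t] is
    either of the two target rates, gives the claim. *)

Set Implicit Arguments.
Unset Strict Implicit.
Unset Printing Implicit Defensive.

Local Open Scope classical_set_scope.
Local Open Scope ring_scope.

(** * Smooth convex functions *)

Section InnerProduct.
Context {R : realType} {d : nat}.
Implicit Types (u v w : 'rV[R]_d) (a : R).

Definition dotv u v : R := \sum_(j < d) u ord0 j * v ord0 j.
Definition sqnorm u : R := dotv u u.

Lemma dotvC u v : dotv u v = dotv v u.
Proof. by apply: eq_bigr => j _; rewrite mulrC. Qed.

Lemma dotvDl u v w : dotv (u + v) w = dotv u w + dotv v w.
Proof. by rewrite -big_split; apply: eq_bigr => j _; rewrite mxE mulrDl. Qed.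

Lemma dotvZl a u v : dotv (a *: u) v = a * dotv u v.
Proof. by rewrite big_distrr; apply: eq_bigr => j _ /=; rewrite mxE mulrA. Qed.

Lemma dotvNl u v : dotv (- u) v = - dotv u v.
Proof. by rewrite -scaleN1r dotvZl mulN1r. Qed.

Lemma dotvBl u v w : dotv (u - v) w = dotv u w - dotv v w.
Proof. by rewrite dotvDl dotvNl. Qed.

Lemma dotvDr u v w : dotv u (v + w) = dotv u v + dotv u w.
Proof. by rewrite dotvC dotvDl !(dotvC u). Qed.

Lemma dotvZr a u v : dotv u (a *: v) = a * dotv u v.
Proof. by rewrite dotvC dotvZl (dotvC u). Qed.

Lemma dotvNr u v : dotv u (- v) = - dotv u v.
Proof. by rewrite dotvC dotvNl (dotvC u). Qed.

Lemma dotvBr u v w : dotv u (v - w) = dotv u v - dotv u w.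
Proof. by rewrite dotvDr dotvNr. Qed.

Lemma dot0v u : dotv 0 u = 0.
Proof. by rewrite -(scale0r 0) dotvZl mul0r. Qed.

Lemma dotv0 u : dotv u 0 = 0.
Proof. by rewrite dotvC dot0v. Qed.

Lemma dotv_suml (I : Type) (r : seq I) (P : pred I) (F : I -> 'rV[R]_d) u :
  dotv (\sum_(i <- r | P i) F i) u = \sum_(i <- r | P i) dotv (F i) u.
Proof. by apply: (big_morph (dotv^~ u)) => [v w|]; rewrite ?dotvDl ?dot0v. Qed.

Lemma dotv_sumr (I : Type) (r : seq I) (P : pred I) (F : I -> 'rV[R]_d) u :
  dotv u (\sum_(i <- r | P i) F i) = \sum_(i <- r | P i) dotv u (F i).
Proof. by rewrite dotvC dotv_suml; apply: eq_bigr => i _; rewrite dotvC. Qed.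

Lemma sqnorm_ge0 u : 0 <= sqnorm u.
Proof. by apply: sumr_ge0 => j _; rewrite -expr2 sqr_ge0. Qed.

Lemma sqnorm0 : sqnorm 0 = 0.
Proof. exact: dotv0. Qed.

Lemma sqnorm_eq0 u : sqnorm u = 0 -> u = 0.
Proof.
move=> /psumr_eq0P u0; apply/rowP => j; rewrite mxE; apply/eqP.
by rewrite -sqrf_eq0 expr2 u0// => i _; rewrite -expr2 sqr_ge0.
Qed.

Lemma sqnormD u v : sqnorm (u + v) = sqnorm u + 2 * dotv u v + sqnorm v.
Proof. by rewrite /sqnorm !dotvDl !dotvDr (dotvC v u); ring. Qed.

Lemma sqnormZ a u : sqnorm (a *: u) = a ^+ 2 * sqnorm u.
Proof. by rewrite /sqnorm dotvZl dotvZr; ring. Qed.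

Lemma sqnormN u : sqnorm (- u) = sqnorm u.
Proof. by rewrite -scaleN1r sqnormZ sqrrN expr1n mul1r. Qed.

Lemma sqnormB u v : sqnorm (u - v) = sqnorm u - 2 * dotv u v + sqnorm v.
Proof. by rewrite sqnormD dotvNr sqnormN; ring. Qed.

Lemma sqnormBC u v : sqnorm (u - v) = sqnorm (v - u).
Proof. by rewrite -opprB sqnormN. Qed.

Lemma sqnormD_le u v : sqnorm (u + v) <= 2 * sqnorm u + 2 * sqnorm v.
Proof. by have := sqnorm_ge0 (u - v); rewrite sqnormB sqnormD; lra. Qed.

Lemma sqnormB_le u v : sqnorm (u - v) <= 2 * sqnorm u + 2 * sqnorm v.
Proof. by rewrite -(sqnormN v) sqnormD_le. Qed.

Lemma dotv_young a u v : 0 < a -> 2 * dotv u v <= a * sqnorm u + sqnorm v / a.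
Proof.
move=> a0; have a_neq0 : a != 0 by rewrite gt_eqF.
have := sqnorm_ge0 (a *: u - v); rewrite sqnormB sqnormZ dotvZl => h.
rewrite -(ler_pM2l a0).
have -> : a * (a * sqnorm u + sqnorm v / a) = a ^+ 2 * sqnorm u + sqnorm v.
  by field.
by lra.
Qed.

Lemma enorm_ge0 u : 0 <= enorm u.
Proof. exact: sqrtr_ge0. Qed.

Lemma enorm_sqr u : enorm u ^+ 2 = sqnorm u.
Proof.
rewrite sqr_sqrtr; last by apply: sumr_ge0 => j _; exact: sqr_ge0.
by apply: eq_bigr => j _; rewrite expr2.
Qed.

(** Cauchy-Schwarz with weights. With [W] the total weight and [S] the sum of the vectors, the right
    side over [W] exceeds the left side over [W] by the sum of
    [sqnorm (u i - (w i / W) *: S) / w i]. *)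
Lemma sqnorm_sum_le (I : finType) (P : pred I) (w : I -> R) (u : I -> 'rV[R]_d) :
  (forall i, 0 < w i) ->
  sqnorm (\sum_(i | P i) u i) <=
    (\sum_(i | P i) w i) * \sum_(i | P i) sqnorm (u i) / w i.
Proof.
move=> w0; set W := \sum_(i | P i) w i; set S := \sum_(i | P i) u i.
(* As all weights are positive, [W = 0] forces an empty index set. *)
have [/eqP WE|W_neq0] := boolP (W == 0).
  have P0 i : P i -> False.
    move=> Pi; have := w0 i; rewrite ltNge => /negP; apply.
    by rewrite -WE /W (bigD1 i)//= lerDl sumr_ge0// => j _; exact: ltW.
  rewrite /S big_pred0 ?sqnorm0; last by move=> i; apply/negP => /P0.
  by rewrite WE mul0r.
have W0 : 0 < W.
  by rewrite lt0r W_neq0 sumr_ge0// => j _; exact: ltW.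
rewrite -ler_pdivrMl// -subr_ge0.
suff -> : \sum_(i | P i) sqnorm (u i) / w i - W^-1 * sqnorm S =
    \sum_(i | P i) sqnorm (u i - (w i / W) *: S) / w i.
  by apply: sumr_ge0 => i _; rewrite divr_ge0 ?sqnorm_ge0 ?ltW.
have E i : sqnorm (u i - (w i / W) *: S) / w i =
    sqnorm (u i) / w i - 2 * W^-1 * dotv (u i) S + W^-2 * w i * sqnorm S.
  by rewrite sqnormB dotvZr sqnormZ; field; rewrite W_neq0 gt_eqF ?w0.
rewrite (eq_bigr _ (fun i _ => E i)) big_split/= sumrB -!mulr_sumr -dotv_suml.
by rewrite -mulr_suml -mulr_sumr -/W -/(sqnorm S); field.
Qed.

End InnerProduct.

(** * First-order inequalities for convex and smooth functions *)

Section FirstOrder.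
Context {R : realType} {d : nat}.
Implicit Types (h : 'rV[R]_d -> R) (x y v : 'rV[R]_d).

Lemma derive_gradient h x v : differentiable h x ->
  'D_v h x = dotv (gradient h x) v.
Proof.
move=> dh; rewrite deriveE// {1}[v]row_sum_delta linear_sum/=.
apply: eq_bigr => j _.
by rewrite linearZ/= -deriveE// mxE mulrC.
Qed.

Lemma is_derive_line h x v (t : R) : differentiable h (x + t *: v) ->
  is_derive t 1 (fun s : R => h (x + s *: v))
    (dotv (gradient h (x + t *: v)) v).
Proof.
move=> dh; rewrite -derive_gradient//.
have E : (fun s : R => s^-1 *: (((fun s : R => h (x + s *: v)) \o shift t)
      (s *: 1) - h (x + t *: v))) =
    (fun s : R => s^-1 *: ((h \o shift (x + t *: v)) (s *: v)
      - h (x + t *: v))).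
  apply/funext => s /=; congr (_ *: (h _ - _)).
  by rewrite [s *: 1]mulr1 scalerDl addrCA.
have : derivable h (x + t *: v) v by exact: diff_derivable.
rewrite /derivable -E => dphi.
by apply: DeriveDef => //; rewrite /derive E.
Qed.

(** Convexity bounds every quotient [(h (x + s *: (y - x)) - h x) / s] with [0 < s <= 1] by
    [h y - h x]; the bound survives the limit from the right at 0. *)
Lemma convex_ge_tangent h x y : differentiable h x ->
  convex_function [set: convex_lmodType 'rV[R]_d] h ->
  h x + dotv (gradient h x) (y - x) <= h y.
Proof.
move=> dh ch.
have dh0 : differentiable h (x + 0 *: (y - x)) by rewrite scale0r addr0.
have [dphi Ephi] := is_derive_line dh0; move: dphi Ephi.
rewrite scale0r addr0 -lerBrDl => dphi <-.
have dcvg : (fun s : R => s^-1 *: (((fun s => h (x + s *: (y - x))) \o shift 0)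
    (s *: 1) - h (x + 0 *: (y - x)))) @ 0^'+ -->
    'D_1 (fun s : R => h (x + s *: (y - x))) (0 : R).
  apply: cvg_trans dphi; apply: cvg_app => A [e egt0 Ae].
  by exists e => // s se s0; apply: Ae => //; exact/lt0r_neq0.
apply: (cvgr_to_le dcvg).
near=> s.
have s0 : 0 < s by [].
have s1 : s <= 1 by near: s; exact: nbhs_right_le.
rewrite /= [s *: 1]mulr1 addr0 scale0r addr0 -[_ *: _]/(s^-1 * _) ler_pdivrMl//.
have := ch (Itv01 (ltW s0) s1) y x (in_setT _) (in_setT _).
rewrite convRE/= /unstable.onem => hc.
have -> : x + s *: (y - x) = s *: y + (1 - s) *: x.
  by rewrite scalerBr /unstable.onem scalerBl scale1r addrCA.
apply: le_trans (_ : s * h y + (1 - s) * h x - h x <= _).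
  by rewrite lerB.
by rewrite /unstable.onem; lra.
Unshelve. all: by end_near. Qed.

(** Instead of integrating, the mean value theorem is applied to [psi], the restriction of [h] to
    the segment minus its linear and quadratic terms: the Lipschitz gradient makes [dpsi]
    nonpositive inside the segment. *)
Lemma smooth_le_quadratic h (L : R) x y : 0 < L -> smooth L h ->
  h y <= h x + dotv (gradient h x) (y - x) + L / 2 * sqnorm (y - x).
Proof.
move=> L0 [dh lh]; set v := y - x; set g := dotv (gradient h x) v.
pose psi (s : R) := h (x + s *: v) - (s * g + s ^+ 2 * (L / 2 * sqnorm v)).
pose dpsi (s : R) := dotv (gradient h (x + s *: v)) v - (g + s * (L * sqnorm v)).
have dpsiP (s : R) : is_derive s 1 psi (dpsi s).
  have ? := is_derive_line (dh (x + s *: v)).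
  rewrite /psi; apply: is_derive_eq.
  rewrite /dpsi /GRing.scale/=; by field.
have [|c] := @MVT _ psi dpsi 0 1 ltr01 (fun s _ => dpsiP s).
  apply: derivable_within_continuous => s _.
  by have [] := dpsiP s.
rewrite in_itv/= => /andP[c0 c1].
have xv : x + v = y by rewrite /v addrC subrK.
rewrite subr0 mulr1 /psi scale0r addr0 scale1r xv => E.
suff : dpsi c <= 0 by rewrite -E; lra.
rewrite /dpsi opprD addrA -dotvBl.
have := lh (x + c *: v) x; rewrite [x + c *: v - x]addrAC subrr add0r.
set w := gradient _ _ - _ => hw.
have hw2 : sqnorm w <= L ^+ 2 * (c ^+ 2 * sqnorm v).
  rewrite -sqnormZ -!enorm_sqr -exprMn lerXn2r ?nnegrE ?mulr_ge0 ?enorm_ge0//.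
  exact: ltW.
(* Young's inequality with weight [L * c] stands in for Cauchy-Schwarz; it needs [c] strictly
   positive. *)
have Lc0 : 0 < L * c by exact: mulr_gt0.
have := dotv_young v w Lc0; rewrite dotvC => hy.
have : sqnorm w / (L * c) <= L * c * sqnorm v.
  by rewrite ler_pdivrMr//; lra.
by lra.
Qed.

(** The value at [z = y - L^-1 *: w] is bounded below by the tangent at [x] and above by the
    quadratic bound at [y]; comparing the two leaves the gradient gap. *)
Lemma smooth_convex_ge h (L : R) x y : 0 < L -> smooth L h ->
  convex_function [set: convex_lmodType 'rV[R]_d] h ->
  h x + dotv (gradient h x) (y - x)
    + sqnorm (gradient h y - gradient h x) / (2 * L) <= h y.
Proof.
move=> L0 sh ch; set w := gradient h y - gradient h x.
pose z := y - L^-1 *: w; set yx := dotv _ (y - x).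
have := convex_ge_tangent z (sh.1 x) ch.
have := smooth_le_quadratic y z L0 sh.
have -> : z - y = - (L^-1 *: w) by rewrite /z addrAC subrr add0r.
have -> : z - x = (y - x) - L^-1 *: w by rewrite /z addrAC.
rewrite sqnormN sqnormZ dotvNr [dotv _ (y - x - _)]dotvBr -/yx !dotvZr.
have E : dotv (gradient h y) w = dotv (gradient h x) w + sqnorm w.
  by rewrite /sqnorm {3}/w dotvBl addrC subrK.
have -> : L / 2 * (L^-1 ^+ 2 * sqnorm w) = sqnorm w / (2 * L).
  by field; rewrite gt_eqF.
have -> : L^-1 * dotv (gradient h y) w =
    L^-1 * dotv (gradient h x) w + 2 * (sqnorm w / (2 * L)).
  by rewrite E; field; rewrite gt_eqF.
by lra.
Qed.

End FirstOrder.

(** * Estimates for one epoch *)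

(** As [(q * p)%g i] is [p (q i)], left multiplication rearranges positions: this is the
    exchangeability of the entries of a uniform permutation. *)
Lemma sum_perm_mul (R : nmodType) (T : finType) (q : {perm T}) (phi : {perm T} -> R) :
  \sum_p phi (q * p)%g = \sum_p phi p.
Proof. by rewrite [RHS](reindex_inj (mulgI q)). Qed.

Lemma sum_over_perm (R : nmodType) (T : finType) (p : {perm T}) (phi : T -> R) :
  \sum_i phi (p i) = \sum_i phi i.
Proof. by rewrite [RHS](reindex_inj (@perm_inj _ p)). Qed.

Lemma sum_ord_const (R : nzRingType) (n : nat) (c : R) :
  \sum_(i < n) c = n%:R * c.
Proof. by rewrite sumr_const card_ord mulr_natl. Qed.

Lemma sum_ord_telescope (V : zmodType) (n : nat) (f : nat -> V) :
  \sum_(i < n) (f i - f i.+1) = f 0%N - f n.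
Proof.
elim: n => [|n IHn]; first by rewrite big_ord0 subrr.
by rewrite big_ord_recr/= IHn addrA subrK.
Qed.

(** * Second moments of sampling without replacement *)

Section PermMoments.
Context {R : realType} {d n : nat}.
Variables (w : 'I_n -> R) (v : 'I_n -> 'rV[R]_d) (i : 'I_n).
Hypothesis w_ge0 : forall j, 0 <= w j.
Hypothesis v_sum0 : \sum_j v j = 0.

(** Expectations are left unnormalized as sums over ['S_n], so even constants such as [B] are summed
    over [p]. [r] and [q] are the diagonal and mixed moments of the entries, weighted by [w] at
    position [i]. *)
Let B := \sum_(p : 'S_n) ((\sum_j w j) * (n%:R^-1 * \sum_j sqnorm (v j))).
Let r a := \sum_(p : 'S_n) w (p i) * sqnorm (v (p a)).
Let q a b := \sum_(p : 'S_n) w (p i) * dotv (v (p a)) (v (p b)).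

Let nP : 0 < n%:R :> R.
Proof. by rewrite ltr0n (leq_trans _ (ltn_ord i)). Qed.

Lemma sum_perm_at (phi : 'I_n -> R) :
  n%:R * \sum_(p : 'S_n) phi (p i) = \sum_(p : 'S_n) \sum_j phi j.
Proof.
under [RHS]eq_bigr => p _ do rewrite -(sum_over_perm p phi).
rewrite exchange_big/= -(sum_ord_const n); apply: eq_bigr => j _.
by rewrite -(sum_perm_mul (tperm i j)); apply: eq_bigr => p _; rewrite permM tpermL.
Qed.

Let r_const a b : a != i -> b != i -> r a = r b.
Proof.
move=> ai bi; rewrite /r -(sum_perm_mul (tperm a b)); apply: eq_bigr => p _.
by rewrite !permM tpermL tpermD.
Qed.

Let qC a b : q a b = q b a.
Proof. by apply: eq_bigr => p _; rewrite dotvC. Qed.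

Let q_constl a b c : a != i -> c != i -> a != b -> c != b -> q a b = q c b.
Proof.
move=> ai ci ab cb; rewrite /q -(sum_perm_mul (tperm a c)); apply: eq_bigr => p _.
by rewrite !permM tpermL !tpermD.
Qed.

(** Positions other than [i] are exchangeable, so all mixed moments share one value. The indices are
    changed one at a time, and in the other order when [c = b] so that the two stay distinct. *)
Let q_const a b c e : a != i -> b != i -> c != i -> e != i ->
  a != b -> c != e -> q a b = q c e.
Proof.
move=> ai bi ci ei ab ce; have [cb|cb] := eqVneq c b.
  by rewrite (@q_constl a b e)// 1?qC -?cb// eq_sym.
by rewrite (@q_constl a b c)// qC (@q_constl b c e)// 1?eq_sym// qC.
Qed.

Let r_le : \sum_(a | a != i) r a <= B.
Proof.
rewrite exchange_big/=.
have -> : B = \sum_(p : 'S_n) w (p i) * \sum_j sqnorm (v j).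
  rewrite /B -!mulr_suml -(sum_perm_at w).
  by field; rewrite gt_eqF.
apply: ler_sum => p _; rewrite -mulr_sumr ler_wpM2l//.
rewrite -(sum_over_perm p (fun j => sqnorm (v j))) [leRHS](bigD1 i)//=.
by rewrite lerDr sqnorm_ge0.
Qed.

(** Because [v] sums to zero, summing out [b] and then [a] collapses the double sum to [w (p i)]
    times [sqnorm (v (p i))] minus nonnegative squares. The mean over [p] of that product is at most
    the total weight times the mean square. *)
Let q_le : \sum_(a | a != i) \sum_(b | (b != i) && (b != a)) q a b <= B.
Proof.
apply: (@le_trans _ _ (\sum_(p : 'S_n) w (p i) * sqnorm (v (p i)))).
  under eq_bigr do rewrite exchange_big/=.
  rewrite exchange_big/=; apply: ler_sum => p _.
  under eq_bigr do rewrite -mulr_sumr -dotv_sumr.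
  rewrite -mulr_sumr ler_wpM2l//.
  have sum_p : \sum_j v (p j) = 0 by rewrite (sum_over_perm p v).
  have E a : a != i -> dotv (v (p a)) (\sum_(b | (b != i) && (b != a)) v (p b)) =
      - dotv (v (p a)) (v (p i)) - sqnorm (v (p a)).
    move=> ai; rewrite -dotvNr -dotvBr; congr dotv.
    move: sum_p; rewrite (bigD1 i)//= (bigD1 a)//= => /eqP.
    by rewrite addrA addrC addr_eq0 opprD => /eqP.
  rewrite (eq_bigr _ E) sumrB sumrN -dotv_suml.
  move: sum_p; rewrite (bigD1 i)//= => /eqP.
  rewrite addrC addr_eq0 => /eqP ->; rewrite dotvNl opprK.
  by rewrite gerBl sumr_ge0// => a _; exact: sqnorm_ge0.
rewrite -(ler_pM2l nP) (sum_perm_at (fun j => w j * sqnorm (v j))) /B mulr_sumr.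
apply: ler_sum => p _.
rewrite mulrCA mulVKf ?gt_eqF// mulr_suml; apply: ler_sum => j _.
by rewrite ler_wpM2l// (bigD1 j)//= lerDl sumr_ge0// => k _; exact: sqnorm_ge0.
Qed.

(** Expanding the square gives diagonal and mixed moments over positions before [i]; each group
    contributes at most [B]. *)
Lemma sum_perm_prefix_sqnorm :
  \sum_(p : 'S_n) w (p i) * sqnorm (\sum_(j < n | (j < i)%N) v (p j)) <=
  2 * \sum_(p : 'S_n) ((\sum_j w j) * (n%:R^-1 * \sum_j sqnorm (v j))).
Proof.
rewrite -/B.
have -> : \sum_(p : 'S_n) w (p i) * sqnorm (\sum_(j < n | (j < i)%N) v (p j)) =
   \sum_(a < n | (a < i)%N) r a +
   \sum_(a < n | (a < i)%N) \sum_(b < n | (b < i)%N && (b != a)) q a b.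
  rewrite -big_split/=.
  under [RHS]eq_bigr do rewrite exchange_big/= -big_split/=.
  rewrite exchange_big/=; apply: eq_bigr => p _.
  rewrite /sqnorm dotv_suml mulr_sumr; apply: eq_bigr => a ai.
  rewrite dotv_sumr (bigD1 a)//= mulrDr.
  by rewrite -[in RHS]mulr_sumr.
have B0 : 0 <= B.
  apply: sumr_ge0 => p _; rewrite mulr_ge0 ?sumr_ge0// mulr_ge0 ?invr_ge0 ?ler0n//.
  by rewrite sumr_ge0// => j _; exact: sqnorm_ge0.
have lt_neq (a : 'I_n) : (a < i)%N -> a != i.
  by move=> ai; rewrite -val_eqE ltn_eqF.
have hr : \sum_(a < n | (a < i)%N) r a <= B.
  apply: le_trans r_le.
  rewrite [leRHS](bigID (fun a : 'I_n => (a < i)%N))/=.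
  under [X in _ <= X + _]eq_bigl => a do rewrite (andb_idl (lt_neq a)).
  rewrite lerDl sumr_ge0// => a _; apply: sumr_ge0 => p _.
  by rewrite mulr_ge0// sqnorm_ge0.
have hq : \sum_(a < n | (a < i)%N) \sum_(b < n | (b < i)%N && (b != a)) q a b <= B.
  (* The mixed moments all agree. If one is nonnegative then all are, and the partial sum is at most
     the full one; otherwise all are negative and the partial sum is at most [0]. *)
  have [[a b] /and4P[/= ai bi ba q0]|qN] := pickP (fun ab : 'I_n * 'I_n =>
    [&& ab.1 != i, ab.2 != i, ab.2 != ab.1 & 0 <= q ab.1 ab.2]).
    have q_ge0 c e : c != i -> e != i -> e != c -> 0 <= q c e.
      by move=> ci ei ec; rewrite (@q_const c e a b)// eq_sym.
    apply: le_trans q_le.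
    rewrite [leRHS](bigID (fun c : 'I_n => (c < i)%N))/=.
    under [X in _ <= X + _]eq_bigl => c do rewrite (andb_idl (lt_neq c)).
    rewrite ler_wpDr//.
      apply: sumr_ge0 => c /andP[ci _]; apply: sumr_ge0 => e /andP[ei ec].
      exact: q_ge0.
    apply: ler_sum => c ci.
    rewrite [leRHS](bigID (fun e : 'I_n => (e < i)%N))/=.
    under [X in _ <= X + _]eq_bigl => e.
      rewrite andbAC (andb_idl (lt_neq e)); over.
    rewrite lerDl; apply: sumr_ge0 => e /andP[/andP[ei ec] _].
    exact: q_ge0 (lt_neq _ ci) ei ec.
  apply: le_trans B0; apply: sumr_le0 => a ai; apply: sumr_le0 => b /andP[bi ba].
  have := qN (a, b); rewrite /= !lt_neq// ba/= => /negbT.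
  by rewrite -ltNge => /ltW.
by rewrite mulrDl mul1r lerD.
Qed.
End PermMoments.

(** * The two one-epoch estimates, for large and for small steps *)

Section Epoch.
Context {R : realType} {d n : nat}.
Variables (F : 'I_n -> 'rV[R]_d -> R) (G : 'I_n -> 'rV[R]_d -> 'rV[R]_d).
Variables (L : 'I_n -> R) (xs x0 : 'rV[R]_d) (eta : R).
Variable (X : 'S_n -> nat -> 'rV[R]_d).
Hypothesis n_gt0 : (0 < n)%N.
Hypothesis L_gt0 : forall i, 0 < L i.
Hypothesis F_ge : forall i x y,
  F i x + dotv (G i x) (y - x) + sqnorm (G i y - G i x) / (2 * L i) <= F i y.
Hypothesis F_le : forall i x y,
  F i y <= F i x + dotv (G i x) (y - x) + L i / 2 * sqnorm (y - x).
Hypothesis G_xs : \sum_i G i xs = 0.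
Hypothesis eta_gt0 : 0 < eta.
Hypothesis etaL : forall i, 6 * (eta * L i) <= 1.
Hypothesis X0 : forall p, X p 0%N = x0.
Hypothesis XS : forall p (i : 'I_n), X p i.+1 = X p i - eta *: G (p i) (X p i).

Let s2 : R := n%:R^-1 * \sum_i sqnorm (G i xs).
Let subopt x := favg F x - favg F xs.

Let n0 : n%:R != 0 :> R. Proof. by rewrite pnatr_eq0 -lt0n. Qed.
Let nP : 0 < n%:R :> R. Proof. by rewrite ltr0n. Qed.

Lemma natr_favg x : n%:R * favg F x = \sum_i F i x.
Proof. by rewrite /favg mulrA divff// mul1r. Qed.

Lemma natr_noise : n%:R * s2 = \sum_i sqnorm (G i xs).
Proof. by rewrite /s2 mulrA divff// mul1r. Qed.

Lemma convex_tangent i x y : F i x + dotv (G i x) (y - x) <= F i y.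
Proof.
apply: le_trans (F_ge i x y); rewrite lerDl divr_ge0 ?sqnorm_ge0//.
by rewrite mulr_ge0// ltW.
Qed.

Lemma favg_tangent x y :
  favg F x + dotv (n%:R^-1 *: \sum_i G i x) (y - x) <= favg F y.
Proof.
rewrite dotvZl dotv_suml -mulrDr ler_wpM2l ?invr_ge0 ?ler0n//.
by rewrite -big_split/=; apply: ler_sum => i _; exact: convex_tangent.
Qed.

Lemma subopt_ge0 x : 0 <= subopt x.
Proof.
by have := favg_tangent xs x; rewrite G_xs scaler0 dot0v addr0 subr_ge0.
Qed.

Lemma prefix_eq (s : nat) (p q : 'S_n) : (s <= n)%N ->
  (forall j : 'I_n, (j < s)%N -> p j = q j) -> X p s = X q s.
Proof.
elim: s => [|s IHs] sn pq; first by rewrite !X0.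
have -> : s.+1 = (Ordinal sn).+1 by [].
rewrite !XS pq// IHs//; first exact: ltnW.
by move=> j js; apply: pq; exact: ltnW.
Qed.

Lemma tperm_prefix (s i : 'I_n) (p : 'S_n) (j : nat) :
  (j <= s)%N -> (j <= i)%N -> X (tperm s i * p)%g j = X p j.
Proof.
move=> js ji; apply: prefix_eq; first by rewrite (leq_trans js)// ltnW.
move=> k kj; rewrite permM tpermD//.
  by rewrite -val_eqE gtn_eqF// (leq_trans kj).
by rewrite -val_eqE gtn_eqF// (leq_trans kj).
Qed.

(** Adding [F_ge] for [x, y] and for [y, x] gives cocoercivity,
    [D / L i <= dotv (x - y) (G i x - G i y)], which dominates the quadratic term since
    [eta * L i <= 1]. *)
Lemma step_nonexpansive i x y :
  sqnorm ((x - eta *: G i x) - (y - eta *: G i y)) <= sqnorm (x - y).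
Proof.
have -> : (x - eta *: G i x) - (y - eta *: G i y) =
    (x - y) - eta *: (G i x - G i y).
  by apply/rowP => j; rewrite !mxE; ring.
rewrite [sqnorm (_ - _ *: _)]sqnormB dotvZr sqnormZ.
set D := sqnorm (G i x - G i y).
have D0 : 0 <= D := sqnorm_ge0 _.
have mono : D / (L i) <= dotv (x - y) (G i x - G i y).
  have := F_ge i x y; have := F_ge i y x.
  rewrite (sqnormBC (G i y)) -/D -(opprB x y) dotvNr.
  have -> : D / (2 * L i) = D / L i / 2 by field; rewrite gt_eqF.
  by rewrite dotvBr [dotv _ (G i x)]dotvC [dotv _ (G i y)]dotvC; lra.
have : eta * D <= D / L i.
  rewrite ler_pdivlMr// mulrAC ler_piMl//.
  by have := etaL i; have := mulr_gt0 eta_gt0 (L_gt0 i); lra.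
move=> hD.
have h2 : eta * (eta * D) <= eta * dotv (x - y) (G i x - G i y).
  by rewrite ler_pM2l//; lra.
have h3 : 0 <= eta * (eta * D) by rewrite !mulr_ge0// ltW.
by move: h2 h3; rewrite !mulrA -expr2; lra.
Qed.

(** Both runs agree up to index [s], where they take gradient steps on different components. From
    there to [i] they use the same components, and nonexpansive steps do not enlarge the gap. *)
Lemma tperm_stable (s i : 'I_n) (p : 'S_n) : (s < i)%N ->
  sqnorm (X (tperm s i * p)%g i - X p i) <=
    eta ^+ 2 * sqnorm (G (p s) (X p s) - G (p i) (X p s)).
Proof.
move=> si.
suff H j : (j <= n)%N -> (s < j <= i)%N ->
    sqnorm (X (tperm s i * p)%g j - X p j) <=
      eta ^+ 2 * sqnorm (G (p s) (X p s) - G (p i) (X p s)).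
  by apply: H; rewrite ?si ?leqnn// ltnW.
elim: j => [//|j IHj jn /andP[sj ji]].
rewrite -[j.+1]/((Ordinal jn).+1) !XS/=.
have [js|sj'] : s = Ordinal jn \/ (s < j)%N.
- by move: sj; rewrite ltnS leq_eqVlt => /orP[/eqP js|]; [left; exact: val_inj|right].
- have js' : j = s by rewrite js.
  rewrite -js permM tpermL js' tperm_prefix ?leqnn 1?ltnW//.
  rewrite -sqnormZ; set u := X p s - _ - _.
  suff -> : u = eta *: (G (p s) (X p s) - G (p i) (X p s)) by [].
  by apply/rowP => k; rewrite !mxE; ring.
- have -> : (tperm s i * p)%g (Ordinal jn) = p (Ordinal jn).
    rewrite permM tpermD// -val_eqE/=; first by rewrite ltn_eqF.
    by rewrite gtn_eqF.
  apply: le_trans (step_nonexpansive _ _ _) _.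
  by apply: IHj; rewrite ?sj'/= ltnW.
Qed.

Lemma sqnorm_grad_gap i x :
  sqnorm (G i x - G i xs) <= 2 * L i * (F i x - F i xs - dotv (G i xs) (x - xs)).
Proof.
have := F_ge i xs x; set q := sqnorm _; set e := dotv _ _ => h.
rewrite mulrC -ler_pdivrMr ?mulr_gt0//; lra.
Qed.

(** Swapping positions [s] and [i] turns component [p s] into [p i]. For [s >= i] the iterate
    [X p i] is unaffected; for [s < i] it moves as bounded by [tperm_stable], and convexity with
    Young's inequality of weight [2 * eta] pays for the move. *)
Lemma sum_perm_component_le (s i : 'I_n) :
  \sum_(p : 'S_n) F (p s) (X p i) <= \sum_(p : 'S_n) (F (p i) (X p i)
    + eta * sqnorm (G (p s) (X p i)) + eta * sqnorm (G (p s) (X p s))).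
Proof.
have e0 := ltW eta_gt0.
have [si|is_] := ltnP s i; last first.
  rewrite -(sum_perm_mul (tperm i s)).
  apply: ler_sum => p _.
  rewrite permM tpermR tperm_prefix// -addrA lerDl.
  by rewrite addr_ge0// mulr_ge0// sqnorm_ge0.
rewrite -(sum_perm_mul (tperm s i)).
have swap1 : \sum_(p : 'S_n) sqnorm (G (p s) (X p i)) =
    \sum_(p : 'S_n) sqnorm (G (p i) (X (tperm s i * p)%g i)).
  rewrite -(sum_perm_mul (tperm s i)).
  by apply: eq_bigr => p _; rewrite permM tpermL.
have swap2 : \sum_(p : 'S_n) sqnorm (G (p s) (X p s)) =
    \sum_(p : 'S_n) sqnorm (G (p i) (X p s)).
  rewrite -(sum_perm_mul (tperm s i)).
  by apply: eq_bigr => p _; rewrite permM tpermL tperm_prefix// ltnW.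
rewrite !big_split/= -!mulr_sumr swap1.
(* By [swap2] the last term splits into halves matching the two squares that bound the
   displacement. *)
have -> : eta * \sum_(p : 'S_n) sqnorm (G (p s) (X p s)) =
    eta / 2 * \sum_(p : 'S_n) sqnorm (G (p s) (X p s)) +
    eta / 2 * \sum_(p : 'S_n) sqnorm (G (p i) (X p s)).
  by rewrite -swap2; field.
rewrite !mulr_sumr -!big_split/=.
apply: ler_sum => p _.
rewrite permM tpermL; set Y := X (tperm s i * p)%g i.
have := convex_tangent (p i) Y (X p i).
have := tperm_stable p si; rewrite -/Y.
have := sqnormB_le (G (p s) (X p s)) (G (p i) (X p s)).
set b := sqnorm (G (p s) _); set c := sqnorm (G (p i) (X p s)).
set a := sqnorm (_ - _) => h1 h2.
have e20 : 0 < 2 * eta by rewrite mulr_gt0.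
have := dotv_young (G (p i) Y) (Y - X p i) e20.
rewrite -(opprB Y) dotvNr => h3 h4.
have h5 : sqnorm (Y - X p i) / (2 * eta) <= eta * (b + c).
  rewrite ler_pdivrMr//; apply: le_trans h2 _.
  have -> : eta * (b + c) * (2 * eta) = eta ^+ 2 * (2 * b + 2 * c) by ring.
  by rewrite ler_pM2l// exprn_gt0.
by lra.
Qed.

Lemma sum_perm_component_min (p : 'S_n) :
  \sum_i (F (p i) xs) = n%:R * favg F xs.
Proof. by rewrite natr_favg (sum_over_perm p (F^~ xs)). Qed.

Lemma sum_perm_noise (p : 'S_n) : \sum_i sqnorm (G (p i) xs) = n%:R * s2.
Proof.
by rewrite natr_noise (sum_over_perm p (fun i => sqnorm (G i xs))).
Qed.

(** By [etaL] the term [D / (2 * L (p i))] is at least [3 * eta * D]. One [eta * D] pays for the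
    squared step; the other two stay on the left for use in [epoch_large_step]. *)
Lemma step_descent (p : 'S_n) (i : 'I_n) :
  2 * eta * (F (p i) (X p i) - F (p i) xs
    + 2 * eta * sqnorm (G (p i) (X p i) - G (p i) xs)) <=
  sqnorm (X p i - xs) - sqnorm (X p i.+1 - xs)
    + 2 * eta ^+ 2 * sqnorm (G (p i) xs).
Proof.
rewrite XS.
have -> : X p i - eta *: G (p i) (X p i) - xs =
   (X p i - xs) - eta *: G (p i) (X p i) by rewrite addrAC.
rewrite [sqnorm (_ - _ *: _)]sqnormB dotvZr sqnormZ.
have := F_ge (p i) (X p i) xs.
rewrite sqnormBC.
set D := sqnorm (G (p i) (X p i) - _).
have hg : sqnorm (G (p i) (X p i)) <= 2 * D + 2 * sqnorm (G (p i) xs).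
  by rewrite -[X in sqnorm X](subrK (G (p i) xs)) sqnormD_le.
rewrite -(opprB (X p i)) dotvNr dotvC.
set u := dotv _ _ => h.
have h1 : 3 * eta * D <= D / (2 * L (p i)).
  rewrite ler_pdivlMr ?mulr_gt0//.
  have -> : 3 * eta * D * (2 * L (p i)) = (6 * (eta * L (p i))) * D by ring.
  by rewrite ler_piMl// sqnorm_ge0.
have h2 : eta * (F (p i) (X p i) + - u + 3 * eta * D) <= eta * F (p i) xs.
  by rewrite ler_pM2l//; lra.
have h3 : eta ^+ 2 * sqnorm (G (p i) (X p i)) <=
  eta ^+ 2 * (2 * D + 2 * sqnorm (G (p i) xs)).
  by rewrite ler_pM2l// exprn_gt0.
by lra.
Qed.

Lemma epoch_descent (p : 'S_n) :
  2 * eta * \sum_(i < n) (F (p i) (X p i) - F (p i) xs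
    + 2 * eta * sqnorm (G (p i) (X p i) - G (p i) xs)) <=
  sqnorm (x0 - xs) - sqnorm (X p n - xs) + 2 * eta ^+ 2 * (n%:R * s2).
Proof.
rewrite mulr_sumr -(sum_perm_noise p) -[X in sqnorm (X - _)](X0 p) mulr_sumr.
rewrite -(sum_ord_telescope n (fun i => sqnorm (X p i - xs))) -big_split/=.
by apply: ler_sum => i _; exact: step_descent.
Qed.

(** Suboptimality at an iterate averages all components there, and [sum_perm_component_le] trades
    each one for the component actually used. The exchange returns 2/3 of the suboptimality, so 1/3
    remains and the descent estimate is used with factor 3/2. *)
Lemma epoch_large_step :
  eta * \sum_(p : 'S_n) \sum_(i < n) subopt (X p i) <=
  \sum_(p : 'S_n) (3 / 2 * (sqnorm (x0 - xs) - sqnorm (X p n - xs))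
    + 15 * n%:R * eta ^+ 2 * s2).
Proof.
have e0 := ltW eta_gt0.
have avg_grad x : eta * \sum_s sqnorm (G s x) <=
    2 / 3 * (n%:R * subopt x) + 2 * eta * (n%:R * s2).
  (* Since the gradients sum to zero at [xs], suboptimality is a sum of Bregman divergences, and
     each controls its gradient gap. *)
  have -> : n%:R * subopt x =
    \sum_s (F s x - F s xs - dotv (G s xs) (x - xs)).
    by rewrite !sumrB -dotv_suml G_xs dot0v subr0 /subopt mulrBr !natr_favg.
  rewrite natr_noise !mulr_sumr -big_split/=.
  apply: ler_sum => s _.
  have h1 : sqnorm (G s x) <= 2 * sqnorm (G s x - G s xs) + 2 * sqnorm (G s xs).
    by rewrite -[X in sqnorm X <= _](subrK (G s xs)) sqnormD_le.
  have h2 := sqnorm_grad_gap s x.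
  set D := sqnorm (G s x - _) in h1 h2; set e := F s x - _ - _ in h2 *.
  have e_ge0 : 0 <= e by have := convex_tangent s xs x; rewrite /e; lra.
  have h3 : eta * D <= 1 / 3 * e.
    apply: le_trans (_ : eta * (2 * L s * e) <= _); first by rewrite ler_pM2l.
    have := ler_wpM2r e_ge0 (etaL s); lra.
  have h4 : eta * sqnorm (G s x) <= eta * (2 * D + 2 * sqnorm (G s xs)).
    by rewrite ler_pM2l.
  lra.
have dev (i : 'I_n) : n%:R * \sum_(p : 'S_n) subopt (X p i) <=
    \sum_(p : 'S_n) (n%:R * (F (p i) (X p i) - favg F xs) +
      (2 / 3 * (n%:R * subopt (X p i)) + 2 * eta * (n%:R * s2)) +
      eta * \sum_s sqnorm (G (p s) (X p s))).
  have E : n%:R * \sum_(p : 'S_n) subopt (X p i) =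
      \sum_s \sum_(p : 'S_n) (F (p s) (X p i) - favg F xs).
    rewrite exchange_big mulr_sumr/=; apply: eq_bigr => p _.
    rewrite sumrB (sum_over_perm p (F^~ (X p i))) -natr_favg mulrBr.
    by rewrite sum_ord_const.
  rewrite E; apply: (@le_trans _ _ (\sum_(s < n) \sum_(p : 'S_n)
     (F (p i) (X p i) - favg F xs + eta * sqnorm (G (p s) (X p i)) +
      eta * sqnorm (G (p s) (X p s))))).
    apply: ler_sum => s _; have := sum_perm_component_le s i.
    by rewrite !(big_split, sumrB)/=; lra.
  rewrite exchange_big/=; apply: ler_sum => p _.
  rewrite !big_split/= -!mulr_sumr !sum_ord_const.
  rewrite (sum_over_perm p (fun s => sqnorm (G s (X p i)))).
  by have := avg_grad (X p i); lra.
have dev2 : 1 / 3 * \sum_(p : 'S_n) \sum_(i < n) subopt (X p i) <=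
    \sum_(p : 'S_n) (\sum_(i < n) (F (p i) (X p i) - F (p i) xs)
      + 2 * eta * (n%:R * s2) + eta * \sum_s sqnorm (G (p s) (X p s))).
  rewrite -(ler_pM2l nP).
  have : \sum_(i < n) (n%:R * \sum_(p : 'S_n) subopt (X p i)) <= _ :=
    ler_sum _ (fun i _ => dev i).
  rewrite -mulr_sumr exchange_big/= [X in _ <= X -> _]exchange_big/= => h.
  have E : \sum_(p : 'S_n) \sum_(i < n) (n%:R * (F (p i) (X p i) - favg F xs) +
       (2 / 3 * (n%:R * subopt (X p i)) + 2 * eta * (n%:R * s2)) +
       eta * \sum_s sqnorm (G (p s) (X p s))) =
    n%:R * \sum_(p : 'S_n) (\sum_(i < n) (F (p i) (X p i) - F (p i) xs)
      + 2 * eta * (n%:R * s2) + eta * \sum_s sqnorm (G (p s) (X p s))) +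
    2 / 3 * (n%:R * \sum_(p : 'S_n) \sum_(i < n) subopt (X p i)).
    rewrite !mulr_sumr -big_split/=; apply: eq_bigr => p _.
    (* The constant [favg F xs] may be replaced by [F (p i) xs]: both have the same total over
       [i]. *)
    have aux (a b c : 'I_n -> R) (m k l : R) : \sum_i c i = n%:R * m ->
        \sum_i (n%:R * (a i - m) + (2 / 3 * (n%:R * b i) + k) + l) =
        n%:R * (\sum_i (a i - c i) + k + l) + 2 / 3 * (n%:R * \sum_i b i).
      move=> cE; rewrite !(big_split, sumrN)/= -!mulr_sumr cE.
      by rewrite !(big_split, sumrN)/= !sum_ord_const; ring.
    exact: aux (sum_perm_component_min p).
  by rewrite E in h; lra.
rewrite -(ler_pM2l eta_gt0) in dev2.
apply: (@le_trans _ _ (3 * (eta * \sum_(p : 'S_n)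
   (\sum_(i < n) (F (p i) (X p i) - F (p i) xs)
      + 2 * eta * (n%:R * s2) + eta * \sum_s sqnorm (G (p s) (X p s)))))).
  by move: dev2; lra.
rewrite !mulr_sumr; apply: ler_sum => p _.
have h1 := epoch_descent p.
have h2 : \sum_s sqnorm (G (p s) (X p s)) <=
    2 * \sum_i sqnorm (G (p i) (X p i) - G (p i) xs) + 2 * (n%:R * s2).
  rewrite -(sum_perm_noise p) !mulr_sumr -big_split/=; apply: ler_sum => i _.
  by rewrite -[X in sqnorm X <= _](subrK (G (p i) xs)) sqnormD_le.
have h3 : eta ^+ 2 * \sum_s sqnorm (G (p s) (X p s)) <= eta ^+ 2 *
    (2 * \sum_i sqnorm (G (p i) (X p i) - G (p i) xs) + 2 * (n%:R * s2)).
  by rewrite ler_pM2l// exprn_gt0.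
move: h1 h3; rewrite big_split/= -mulr_sumr.
set a := \sum_(i < n) (_ - _); set b := \sum_(i < n) sqnorm (_ - _).
set c := \sum_(i < n) sqnorm _; set k := n%:R * s2.
have -> : 15 * n%:R * eta ^+ 2 * s2 = 15 * eta ^+ 2 * k by rewrite /k; ring.
have -> : 3 * (eta * (a + 2 * eta * k + eta * c)) =
  3 * (eta * a) + 6 * (eta ^+ 2 * k) + 3 * (eta ^+ 2 * c) by ring.
by lra.
Qed.

Lemma iterate_sum (p : 'S_n) (m : nat) : (m <= n)%N ->
  X p m = x0 - eta *: \sum_(j < n | (j < m)%N) G (p j) (X p j).
Proof.
elim: m => [_|m IHm mn]; first by rewrite X0 big_pred0// scaler0 subr0.
have -> : X p m.+1 = X p m - eta *: G (p (Ordinal mn)) (X p m).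
  exact: (XS p (Ordinal mn)).
rewrite {1}(IHm (ltnW mn)).
rewrite [in RHS](bigD1 (Ordinal mn))//= scalerDr opprD addrA addrAC.
congr (_ - _ *: _ - _ *: _); apply: eq_bigl => j.
by rewrite -val_eqE/= ltnS ltn_neqAle andbC.
Qed.

Lemma favg_quadratic x y :
  favg F y <= favg F x + dotv (n%:R^-1 *: \sum_i G i x) (y - x)
    + Lbar L / 2 * sqnorm (y - x).
Proof.
rewrite dotvZl dotv_suml /Lbar -!mulrA -!mulrDr ler_wpM2l ?invr_ge0 ?ler0n//.
rewrite mulr_suml -!big_split/=; apply: ler_sum => i _.
by rewrite mulrA F_le.
Qed.

Lemma Lbar_gt0 : 0 < Lbar L.
Proof.
rewrite mulr_gt0 ?invr_gt0// (bigD1 (Ordinal n_gt0))//= ltr_wpDr//.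
by apply: sumr_ge0 => i _; exact: ltW.
Qed.

(** A gradient step of size [1 / Lbar] cannot go below the minimum, hence
    [sqnorm g <= 2 * Lbar L * subopt x]; Young's inequality then splits the linear term of the
    quadratic bound. *)
Lemma subopt_growth x y :
  subopt y <= 2 * subopt x + Lbar L * sqnorm (y - x).
Proof.
have Lb0 := Lbar_gt0.
set g := n%:R^-1 *: \sum_i G i x.
have hg : sqnorm g / Lbar L <= 2 * subopt x.
  have := favg_quadratic x (x - (Lbar L)^-1 *: g).
  have := subopt_ge0 (x - (Lbar L)^-1 *: g).
  have -> : x - (Lbar L)^-1 *: g - x = - ((Lbar L)^-1 *: g).
    by rewrite addrAC subrr add0r.
  rewrite -/g dotvNr dotvZr sqnormN sqnormZ -/(sqnorm g).
  have -> : Lbar L / 2 * ((Lbar L)^-1 ^+ 2 * sqnorm g) = sqnorm g / Lbar L / 2.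
    by field; rewrite gt_eqF.
  by rewrite /subopt [_^-1 * _]mulrC; lra.
have := favg_quadratic x y; rewrite -/g.
have := dotv_young (y - x) g Lb0; rewrite dotvC.
by move: hg; rewrite /subopt; lra.
Qed.

Lemma epoch_small_step : 4 * (eta * \sum_i L i) <= 1 ->
  eta * \sum_(p : 'S_n) \sum_(i < n) subopt (X p i) <=
  \sum_(p : 'S_n) (sqnorm (x0 - xs) - sqnorm (X p n - xs)
    + 8 * n%:R * eta ^+ 2 * (eta * n%:R * Lbar L) * s2).
Proof.
move=> eta4; have e0 := ltW eta_gt0.
pose S (p : 'S_n) (i : 'I_n) := sqnorm (\sum_(j < n | (j < i)%N) G (p j) xs).
set Lam := \sum_i L i in eta4.
have Lam0 : 0 <= Lam by apply: sumr_ge0 => i _; exact: ltW.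
have LamE : n%:R * Lbar L = Lam by rewrite mulrA divff// mul1r.
have pointwise (p : 'S_n) : eta * \sum_(i < n) subopt (X p i) <=
    sqnorm (x0 - xs) - sqnorm (X p n - xs)
    + 2 * eta ^+ 3 * \sum_(i < n) (L (p i) + Lbar L) * S p i.
  (* [E] collects the cocoercivity gains of the epoch; every deviation below is bounded by [E] and
     the noise prefixes [S p i]. *)
  pose D (i : 'I_n) := sqnorm (G (p i) (X p i) - G (p i) xs).
  pose E := \sum_i D i / L (p i).
  have D0 i : 0 <= D i by exact: sqnorm_ge0.
  have E0 : 0 <= E by apply: sumr_ge0 => i _; rewrite divr_ge0// ltW.
  have drift_le (i : 'I_n) :
      sqnorm (X p i - x0) <= eta ^+ 2 * (2 * (Lam * E) + 2 * S p i).
    rewrite iterate_sum 1?ltnW// addrAC subrr add0r sqnormN sqnormZ.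
    rewrite ler_pM2l ?exprn_gt0//.
    have -> : \sum_(j < n | (j < i)%N) G (p j) (X p j) =
      \sum_(j < n | (j < i)%N) (G (p j) (X p j) - G (p j) xs) +
      \sum_(j < n | (j < i)%N) G (p j) xs by rewrite sumrB subrK.
    apply: le_trans (sqnormD_le _ _) _; rewrite lerD2r ler_pM2l//.
    (* The weights [L (p j)] make the two factors at most [Lam] and [E]. *)
    apply: le_trans (@sqnorm_sum_le _ _ _ _ (fun j => L (p j)) _ _) _ => //.
    rewrite /Lam -(sum_over_perm p L) /E ler_pM//.
    - by apply: sumr_ge0 => j _; exact: ltW.
    - by apply: sumr_ge0 => j _; rewrite divr_ge0 ?sqnorm_ge0 ?ltW.
    - rewrite [leRHS](bigID (fun j : 'I_n => (j < i)%N))/= lerDl.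
      by apply: sumr_ge0 => j _; exact: ltW.
    - rewrite [leRHS](bigID (fun j : 'I_n => (j < i)%N))/= lerDl.
      by apply: sumr_ge0 => j _; rewrite divr_ge0 ?sqnorm_ge0 ?ltW.
  (* Three-point inequality: the quadratic bound from [X p i] to [x0] is combined with the
     cocoercive lower bound from [X p i] to [xs]. *)
  have inner_ge (i : 'I_n) : F (p i) x0 - F (p i) xs + D i / L (p i) / 2
      - L (p i) / 2 * sqnorm (X p i - x0) <= dotv (G (p i) (X p i)) (x0 - xs).
    have := F_ge (p i) (X p i) xs; have := F_le (p i) (X p i) x0.
    rewrite (sqnormBC (G _ xs)) -/(D i) (sqnormBC x0).
    have -> : D i / (2 * L (p i)) = D i / L (p i) / 2.
      by field; rewrite gt_eqF.
    have -> : x0 - xs = (x0 - X p i) - (xs - X p i).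
      by rewrite opprB addrA subrK.
    by rewrite [dotv _ (x0 - _ - _)]dotvBr; lra.
  set V := \sum_i L (p i) * sqnorm (X p i - x0).
  have total_inner : n%:R * subopt x0 + E / 2 - V / 2 <=
      dotv (\sum_i G (p i) (X p i)) (x0 - xs).
    rewrite dotv_suml /subopt mulrBr !natr_favg.
    rewrite -(sum_over_perm p (F^~ x0)) -(sum_over_perm p (F^~ xs)).
    rewrite /E /V !mulr_suml -sumrB -big_split -sumrB/=.
    by apply: ler_sum => i _; have := inner_ge i; lra.
  have V_le : V <= eta ^+ 2 * (2 * (Lam ^+ 2 * E) + 2 * \sum_i L (p i) * S p i).
    apply: (@le_trans _ _ (\sum_i L (p i) * (eta ^+ 2 * (2 * (Lam * E) + 2 * S p i)))).
      by apply: ler_sum => i _; rewrite ler_pM2l.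
    have -> : \sum_i L (p i) * (eta ^+ 2 * (2 * (Lam * E) + 2 * S p i)) =
        (\sum_i L (p i)) * (2 * eta ^+ 2 * (Lam * E))
         + 2 * eta ^+ 2 * \sum_i L (p i) * S p i.
      rewrite [X in _ = X + _]mulr_suml [X in _ = _ + X]mulr_sumr -big_split/=.
      by apply: eq_bigr => i _; ring.
    by rewrite sum_over_perm -/Lam; lra.
  have sub_le : \sum_(i < n) subopt (X p i) <= 2 * (n%:R * subopt x0) +
      eta ^+ 2 * (2 * (Lam ^+ 2 * E) + 2 * \sum_i Lbar L * S p i).
    apply: (@le_trans _ _ (\sum_(i < n) (2 * subopt x0 +
        Lbar L * (eta ^+ 2 * (2 * (Lam * E) + 2 * S p i))))).
      apply: ler_sum => i _; apply: le_trans (subopt_growth x0 _) _.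
      by rewrite lerD2l ler_pM2l// Lbar_gt0.
    have -> : \sum_(i < n) (2 * subopt x0 +
        Lbar L * (eta ^+ 2 * (2 * (Lam * E) + 2 * S p i))) =
        n%:R * (2 * subopt x0 + 2 * eta ^+ 2 * (Lbar L * (Lam * E)))
        + 2 * eta ^+ 2 * \sum_i Lbar L * S p i.
      rewrite -(sum_ord_const n) [X in _ = _ + X]mulr_sumr -big_split/=.
      by apply: eq_bigr => i _; ring.
    by rewrite -LamE le_eqVlt; apply/orP; left; apply/eqP; ring.
  have last_le : sqnorm (\sum_i G (p i) (X p i)) <= Lam * E.
    have -> : \sum_i G (p i) (X p i) = \sum_i (G (p i) (X p i) - G (p i) xs).
      by rewrite sumrB (sum_over_perm p (G^~ xs)) G_xs subr0.
    rewrite /Lam -(sum_over_perm p L).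
    by apply: (@sqnorm_sum_le _ _ _ _ (fun j => L (p j))).
  have last : sqnorm (X p n - xs) = sqnorm (x0 - xs)
      - 2 * eta * dotv (\sum_i G (p i) (X p i)) (x0 - xs)
      + eta ^+ 2 * sqnorm (\sum_i G (p i) (X p i)).
    rewrite iterate_sum// addrAC.
    under eq_bigl do rewrite ltn_ord.
    by rewrite [LHS]sqnormB sqnormZ dotvZr dotvC; ring.
  rewrite last.
  set I := dotv _ _ in total_inner *; set Q := sqnorm _ in last_le *.
  (* With [eta * Lam <= 1/4], the gain [eta * E] covers [eta * E / 4] from the squared epoch step
     and [eta * E / 8] from each of [V] and the suboptimality sum. *)
  have h1 : eta ^+ 2 * Q <= eta * (E / 4).
    apply: (@le_trans _ _ (eta * ((eta * Lam) * E))).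
      have -> : eta * (eta * Lam * E) = eta ^+ 2 * (Lam * E) by ring.
      by rewrite ler_pM2l// exprn_gt0.
    by rewrite ler_pM2l//; have := ler_wpM2r E0 eta4; lra.
  have h2 : eta ^+ 2 * (Lam ^+ 2 * E) <= E / 16.
    have : (4 * (eta * Lam)) ^+ 2 <= 1.
      by rewrite expr_le1// !mulr_ge0.
    by move=> /(ler_wpM2r E0); lra.
  have h3 := ler_wpM2l e0 sub_le.
  have h4 : eta * V <= eta *
    (eta ^+ 2 * (2 * (Lam ^+ 2 * E) + 2 * \sum_i L (p i) * S p i)).
    by rewrite ler_pM2l.
  have h5 := ler_wpM2l e0 total_inner.
  have h6 := ler_wpM2l e0 h2.
  have h7 : 0 <= eta * E by rewrite mulr_ge0.
  have -> : \sum_i (L (p i) + Lbar L) * S p i =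
      \sum_i L (p i) * S p i + \sum_i Lbar L * S p i.
    by rewrite -big_split/=; apply: eq_bigr => i _; rewrite mulrDl.
  by lra.
rewrite mulr_sumr; apply: le_trans (ler_sum _ (fun p _ => pointwise p)) _.
rewrite big_split [leRHS]big_split/= lerD2l -mulr_sumr exchange_big/=.
(* The moment bound is used with weights [L j + Lbar L], whose total is [2 * Lam]. *)
have moment (i : 'I_n) : \sum_(p : 'S_n) (L (p i) + Lbar L) * S p i <=
    2 * \sum_(p : 'S_n) (2 * Lam) * s2.
  have := @sum_perm_prefix_sqnorm R d n (fun j => L j + Lbar L) (G^~ xs) i.
  rewrite big_split/= sum_ord_const LamE -/Lam -/s2 -(mulr2n Lam) -(mulr_natl Lam).
  by apply => // j; rewrite addr_ge0 ?ltW ?Lbar_gt0.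
apply: (@le_trans _ _ (2 * eta ^+ 3 *
    \sum_(i < n) (2 * \sum_(p : 'S_n) (2 * Lam) * s2))).
  by rewrite ler_pM2l ?mulr_gt0 ?exprn_gt0//; apply: ler_sum.
have -> : Lam = n%:R * Lbar L by [].
rewrite sum_ord_const !mulr_sumr le_eqVlt; apply/orP; left; apply/eqP.
by apply: eq_bigr => p _; ring.
Qed.

End Epoch.

(** * Averaging over epochs *)

Section Trajectory.
Context {R : realType} {d n K : nat}.
Variables (G : 'I_n -> 'rV[R]_d -> 'rV[R]_d) (eta : R).
Implicit Types (x : 'rV[R]_d) (p : 'S_n) (q : {ffun 'I_K -> 'S_n}).

(** Made total in the index: once [insub] fails, that is past [n] steps here or past [K] epochs
    below, the point stays put. *)
Fixpoint epoch_iter p x (i : nat) : 'rV[R]_d :=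
  if i is j.+1 then
    let y := epoch_iter p x j in
    if insub j is Some o then y - eta *: G (p o) y else y
  else x.

Fixpoint epoch_start q x (k : nat) : 'rV[R]_d :=
  if k is j.+1 then
    let y := epoch_start q x j in
    if insub j is Some o then epoch_iter (q o) y n else y
  else x.

Lemma epoch_iterS p x (i : 'I_n) :
  epoch_iter p x i.+1 = epoch_iter p x i - eta *: G (p i) (epoch_iter p x i).
Proof. by rewrite /= valK. Qed.

Lemma epoch_startS q x (k : 'I_K) :
  epoch_start q x k.+1 = epoch_iter (q k) (epoch_start q x k) n.
Proof. by rewrite /= valK. Qed.

Lemma epoch_start_prefix q q' x (k : nat) :
  (forall j : 'I_K, (j < k)%N -> q j = q' j) ->
  epoch_start q x k = epoch_start q' x k.
Proof.
elim: k => [//|k IHk qq'] /=; rewrite IHk; last first.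
  by move=> j jk; apply: qq'; exact: ltnW.
by case: insubP => // o _ oE; rewrite qq'// oE.
Qed.

(* The epoch permutation [q k] is independent of the point at which the epoch
   starts: multiplying [q k] by any permutation is a measure-preserving
   bijection that keeps [epoch_start q x k]. *)
Lemma sum_epoch_fresh (k : 'I_K) x (phi : 'S_n -> 'rV[R]_d -> R) :
  #|{perm 'I_n}|%:R * \sum_(q : {ffun 'I_K -> 'S_n}) phi (q k) (epoch_start q x k) =
  \sum_(q : {ffun 'I_K -> 'S_n}) \sum_(p : 'S_n) phi p (epoch_start q x k).
Proof.
pose upd s q : {ffun 'I_K -> 'S_n} :=
  [ffun j => if j == k then (s * q j)%g else q j].
have upd_inj s : injective (upd s).
  move=> q q' /ffunP E; apply/ffunP => j; have := E j; rewrite !ffunE.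
  by case: eqP => // _ /mulgI.
have upd_start s q : epoch_start (upd s q) x k = epoch_start q x k.
  apply: epoch_start_prefix => j jk; rewrite ffunE.
  by case: eqP => // jE; rewrite jE ltnn in jk.
transitivity (\sum_(s : 'S_n) \sum_(q : {ffun 'I_K -> 'S_n})
    phi (s * q k)%g (epoch_start q x k)).
  rewrite [RHS](eq_bigr (fun=> \sum_(q : {ffun 'I_K -> 'S_n})
      phi (q k) (epoch_start q x k))).
    by rewrite sumr_const mulr_natl.
  move=> s _; rewrite [RHS](reindex_inj (@upd_inj s)); apply: eq_bigr => q _.
  by rewrite upd_start ffunE eqxx.
rewrite exchange_big; apply: eq_bigr => q _.
by rewrite [RHS](reindex_inj (mulIg (q k))).
Qed.

(** The one-epoch bound holds from every start, hence on average from the random one; the squared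
    distances telescope and the last is dropped. *)
Lemma sum_epochs_le (h : 'rV[R]_d -> R) (xs x1 : 'rV[R]_d) (a c : R) :
  (forall x, eta * \sum_(p : 'S_n) \sum_(i < n) h (epoch_iter p x i) <=
    \sum_(p : 'S_n) (a * (sqnorm (x - xs) - sqnorm (epoch_iter p x n - xs)) + c)) ->
  0 <= a ->
  eta * \sum_(q : {ffun 'I_K -> 'S_n}) \sum_(k < K) \sum_(i < n)
     h (epoch_iter (q k) (epoch_start q x1 k) i) <=
  \sum_(q : {ffun 'I_K -> 'S_n}) (a * sqnorm (x1 - xs) + K%:R * c).
Proof.
move=> epoch_le a0.
pose phi p x := eta * \sum_(i < n) h (epoch_iter p x i)
  - (a * (sqnorm (x - xs) - sqnorm (epoch_iter p x n - xs)) + c).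
have phi_le (k : 'I_K) :
    \sum_(q : {ffun 'I_K -> 'S_n}) phi (q k) (epoch_start q x1 k) <= 0.
  have cardP : 0 < #|{perm 'I_n}|%:R :> R.
    by rewrite ltr0n; apply/card_gt0P; exists 1%g.
  (* Multiplying by the number of permutations replaces [q k] by a fresh [p], so the hypothesis
     applies for each fixed start. *)
  rewrite -(pmulr_rle0 _ cardP) sum_epoch_fresh; apply: sumr_le0 => q _.
  by rewrite sumrB -mulr_sumr subr_le0.
have : \sum_(k < K) \sum_(q : {ffun 'I_K -> 'S_n}) phi (q k) (epoch_start q x1 k) <= 0.
  exact: sumr_le0.
rewrite exchange_big/= => h1.
rewrite mulr_sumr -subr_le0 -sumrB; apply: le_trans h1; apply: ler_sum => q _.
rewrite /phi sumrB big_split/= sum_ord_const -!mulr_sumr lerB// lerD2r ler_wpM2l//.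
under eq_bigr do rewrite -epoch_startS.
rewrite (sum_ord_telescope K (fun k => sqnorm (epoch_start q x1 k - xs))).
by rewrite gerBl sqnorm_ge0.
Qed.

Lemma shuffling_sgd_trajectory (f : 'I_n -> 'rV[R]_d -> R) (q : {ffun 'I_K -> 'S_n})
    (pi : 'I_K -> 'S_n) x1 (x : nat -> nat -> 'rV[R]_d) (k : 'I_K) (i : nat) :
  (forall j, G j = gradient (f j)) -> pi =1 q ->
  shuffling_sgd f (fun=> eta) pi x1 x -> (i <= n)%N ->
  x k i = epoch_iter (q k) (epoch_start q x1 k) i.
Proof.
move=> GE piq [x00 xS xn].
have inner (l : 'I_K) j : (j <= n)%N ->
    x l j = epoch_iter (q l) (x l 0%N) j.
  elim: j => [//|j IHj jn].
  by rewrite -[j.+1]/((Ordinal jn).+1) xS epoch_iterS/= -IHj ?GE ?piq// ltnW.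
have start (l : nat) : (l < K)%N -> x l 0%N = epoch_start q x1 l.
  elim: l => [//|l IHl lK].
  pose o := Ordinal (ltnW lK).
  by rewrite -[l.+1]/(o.+1) epoch_startS xn inner// -IHl// ltnW.
by move=> iN; rewrite inner// start.
Qed.
End Trajectory.

(** * Jensen's inequality for the averaged iterate *)

Section Jensen.
Context {R : realType} {d n : nat}.
Variables (F : 'I_n -> 'rV[R]_d -> R) (G : 'I_n -> 'rV[R]_d -> 'rV[R]_d).
Hypothesis F_tangent : forall i x y, F i x + dotv (G i x) (y - x) <= F i y.

(** With a constant stepsize all weights equal [1 / (n K)]. The tangent at the average [z] lies
    below [favg F], and its linear part cancels because the deviations from [z] sum to zero. *)
Lemma favg_averaged_iterate (K : nat) (eta : R) (x : nat -> nat -> 'rV[R]_d)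
    (f0 : R) : (0 < n)%N -> (0 < K)%N -> 0 < eta ->
  n%:R * K%:R * (favg F (averaged_iterate n (fun _ : 'I_K => eta) x) - f0) <=
  \sum_(k < K) \sum_(i < n) (favg F (x k i) - f0).
Proof.
move=> n_gt0 K_gt0 eta_gt0.
have nP : 0 < n%:R :> R by rewrite ltr0n.
have KP : 0 < K%:R :> R by rewrite ltr0n.
set z := averaged_iterate _ _ _.
have zE : (n%:R * K%:R) *: z = \sum_(k < K) \sum_(i < n) x k i.
  rewrite /z /averaged_iterate scaler_sumr; apply: eq_bigr => k _.
  rewrite scaler_sumr; apply: eq_bigr => i _.
  rewrite scalerA sum_ord_const.
  have -> : n%:R * K%:R * (eta / (n%:R * (K%:R * eta))) = 1.
    by field; rewrite !gt_eqF.
  by rewrite scale1r.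
pose g := n%:R^-1 *: \sum_i G i z.
have tangent y : favg F z - f0 + dotv g (y - z) <= favg F y - f0.
  rewrite addrAC lerD2r /g dotvZl dotv_suml -mulrDr ler_wpM2l ?invr_ge0 ?ler0n//.
  by rewrite -big_split/=; apply: ler_sum => i _.
apply: (@le_trans _ _ (\sum_(k < K) \sum_(i < n)
    (favg F z - f0 + dotv g (x k i - z)))).
  have dev0 : \sum_(k < K) \sum_(i < n) (x k i - z) = 0.
    under eq_bigr do rewrite sumrB sumr_const card_ord.
    rewrite sumrB -zE sumr_const card_ord -mulrnA -(scaler_nat (n * K)) natrM.
    by rewrite subrr.
  under eq_bigr do rewrite big_split/= sum_ord_const -dotv_sumr.
  by rewrite big_split/= sum_ord_const -dotv_sumr dev0 dotv0 addr0 mulrCA mulrA.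
by apply: ler_sum => k _; apply: ler_sum => i _.
Qed.
End Jensen.

(** * Expectation as a finite average over permutation tuples *)

Section Expectation.
Context {disp : measure_display} {T : measurableType disp} {R : realType}.
Variables (P : probability T R) (n K : nat) (pi : 'I_K -> T -> 'S_n).

(** The events [A q] partition the space, and independence gives each the same probability.
    Measurability of the integrand comes from that of [pi], as it is a finite combination of
    indicators; [phi >= 0] lets the integral pass through the sum. *)
Lemma expectation_reshuffling (phi : {ffun 'I_K -> 'S_n} -> R) :
  random_reshuffling P pi -> (forall q, 0 <= phi q) ->
  ('E_P[fun w => phi [ffun k => pi k w]] =
  ((#|{perm 'I_n}|%:R^-1) ^+ K * \sum_(q : {ffun 'I_K -> 'S_n}) phi q)%:E)%E.
Proof.
move=> [pi_meas pi_indep pi_unif] phi0.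
pose A (q : {ffun 'I_K -> 'S_n}) := [set w | forall k, k \in [set: 'I_K]%SET ->
    pi k w \in [set q k]%SET].
have AE q w : A q w <-> [ffun k => pi k w] = q.
  split=> [Aqw|<- k _]; last by rewrite ffunE inE.
  by apply/ffunP => k; rewrite ffunE; apply/set1P; exact: Aqw.
have Am q : measurable (A q).
  have -> : A q = \bigcap_(k in [set: 'I_K]) [set w | pi k w = q k].
    apply/seteqP; split=> w /=.
      by move=> /AE <- k _ /=; rewrite ffunE.
    by move=> wq; apply/AE/ffunP => k; rewrite ffunE; exact: wq.
  by apply: fin_bigcap_measurable => // k _; exact: pi_meas.
have PA q : P (A q) = ((#|{perm 'I_n}|%:R^-1) ^+ K)%:E.
  rewrite /A pi_indep.
  rewrite (eq_bigr (fun=> (#|{perm 'I_n}|%:R^-1)%:E)); last first.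
    move=> k _; rewrite -(pi_unif k (q k)); congr (P _).
    by apply/seteqP; split=> w /=; rewrite inE => /eqP.
  rewrite prodEFin prodr_const.
  by rewrite cardsT card_ord.
rewrite unlock.
transitivity (\int[P]_w \sum_(q : {ffun 'I_K -> 'S_n})
    ((phi q)%:E * (\1_(A q) w)%:E))%E.
  apply: eq_integral => w _.
  rewrite (bigD1 [ffun k => pi k w])//= indicE mem_set; last exact/AE.
  rewrite mule1 big1 ?adde0// => q qw; rewrite indicE memNset ?mule0//.
  by move=> /AE wq; rewrite wq eqxx in qw.
rewrite ge0_integral_sum//; first last.
- by move=> q w _; rewrite lee_fin mulr_ge0.
- move=> q; apply: measurable_funeM; apply/measurable_EFinP.
  exact: measurable_indic.
rewrite mulr_sumr -sumEFin; apply: eq_bigr => q _.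
rewrite ge0_integralZl_EFin//; last first.
  by apply/measurable_EFinP; exact: measurable_indic.
rewrite integral_indic// setIT mulrC EFinM; congr (_ * _)%E; exact: PA.
Qed.
End Expectation.

(** * Optimal stepsizes *)

Section Tuning.
Context {R : realType}.
Variables (n K : nat) (D Lb Lh sigma : R).
Hypotheses (n_gt0 : (0 < n)%N) (K_gt0 : (0 < K)%N).
Hypotheses (Lb_gt0 : 0 < Lb) (Lh_gt0 : 0 < Lh).
Hypotheses (D_ge0 : 0 <= D) (sigma_ge0 : 0 <= sigma).

Let nP : 0 < n%:R :> R. Proof. by rewrite ltr0n. Qed.
Let KP : 0 < K%:R :> R. Proof. by rewrite ltr0n. Qed.
Let NP : 0 < n%:R * K%:R :> R. Proof. exact: mulr_gt0. Qed.
Let bound := rr_bound n K D Lb sigma.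
Let emax := 1 / (6 * Lh).

Let emax_gt0 : 0 < emax.
Proof. by rewrite divr_gt0// mulr_gt0. Qed.

(** For [sigma = 0] the bound is nonincreasing, so [emax] is optimal. For [D > 0] it blows up near
    0, which confines the search to a compact interval. *)
Lemma exists_optimally_tuned : 0 < D \/ sigma = 0 ->
  exists eta, optimally_tuned n K D Lb Lh sigma eta.
Proof.
case=> [D_gt0|sigma0]; last first.
  exists emax; split=> // e e0 ee; rewrite /rr_bound sigma0 expr0n/= !mulr0 !addr0.
  have pos (x : R) : 0 < x -> 0 < x * n%:R * K%:R.
    by move=> x0; exact: mulr_gt0 (mulr_gt0 x0 nP) KP.
  rewrite ler_wpM2l ?mulr_ge0 ?sqr_ge0// lef_pV2 ?posrE ?pos//.
  by rewrite !ler_pM2r.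
set A := 6 * D ^+ 2 / (n%:R * K%:R).
have A0 : 0 < A by rewrite divr_gt0// mulr_gt0// exprn_gt0.
have boundE e : 0 < e ->
    bound e = A / e + 51 * Num.min e (e ^+ 2 * n%:R * Lb) * sigma ^+ 2.
  move=> e0; rewrite /bound /rr_bound /A; congr (_ + _).
  by field; rewrite !gt_eqF.
have bound_ge e : 0 < e -> A / e <= bound e.
  move=> e0; rewrite boundE// lerDl mulr_ge0 ?sqr_ge0// mulr_ge0//.
  by rewrite le_min ltW//= !mulr_ge0// ltW.
have M0 : 0 < bound emax by apply: lt_le_trans (bound_ge _ emax_gt0); rewrite divr_gt0.
(* Below [A / bound emax] the term [A / e] alone exceeds [bound emax]. *)
pose del := Num.min emax (A / bound emax).
have del0 : 0 < del by rewrite lt_min emax_gt0 divr_gt0.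
have del_le : del <= emax by rewrite ge_min lexx.
have [|c] := @EVT_min R bound del emax del_le.
  apply: continuous_in_subspaceT => e; rewrite inE/= in_itv/= => /andP[de _].
  have e0 : 0 < e by apply: lt_le_trans de.
  apply: cvgD.
    apply: cvgMl_tmp; apply: cvgV; first by rewrite !mulf_neq0 ?gt_eqF.
    by apply: cvgMr_tmp; apply: cvgMr_tmp; exact: cvg_id.
  apply: cvgMr_tmp; apply: cvgMl_tmp.
  apply: (@continuous_min R R id (fun e => e ^+ 2 * n%:R * Lb)); first exact: cvg_id.
  apply: cvgMr_tmp; apply: cvgMr_tmp; exact: exprn_continuous.
rewrite in_itv/= => /andP[dc ce] cmin; exists c.
split=> //; first exact: lt_le_trans dc.
move=> e e0 ee; have [de|ed] := leP del e.
  by apply: cmin; rewrite in_itv/= de.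
apply: (@le_trans _ _ (bound emax)); first by apply: cmin; rewrite in_itv/= del_le lexx.
apply: le_trans (bound_ge _ e0).
have : e < A / bound emax by apply: lt_le_trans ed _; rewrite ge_min lexx orbT.
by rewrite ltr_pdivlMr// ler_pdivlMr// mulrC => /ltW.
Qed.

(** The optimum is compared with [e] capped at [emax]: the first term at the cap is at most the sum
    of its values at [e] and [emax], the latter giving the factor 36, and the noise term is
    monotone. *)
Lemma optimal_bound_le (eta e : R) : optimally_tuned n K D Lb Lh sigma eta -> 0 < e ->
  bound eta <= 36 * (Lh * D ^+ 2 / (n%:R * K%:R)) + 6 * D ^+ 2 / (e * n%:R * K%:R)
    + 51 * Num.min e (e ^+ 2 * n%:R * Lb) * sigma ^+ 2.
Proof.
move=> [_ _ opt] e0; pose e' := Num.min e emax.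
have e'0 : 0 < e' by rewrite lt_min e0 emax_gt0.
have e'e : e' <= e by rewrite ge_min lexx.
apply: le_trans (opt e' e'0 _) _; first by rewrite ge_min lexx orbT.
apply: lerD.
  set A := D ^+ 2 / (n%:R * K%:R).
  have A0 : 0 <= A by rewrite divr_ge0 ?sqr_ge0// ltW.
  have -> : 6 * D ^+ 2 / (e' * n%:R * K%:R) = 6 * A / e'.
    by rewrite /A; field; rewrite !gt_eqF.
  have -> : 36 * (Lh * D ^+ 2 / (n%:R * K%:R)) + 6 * D ^+ 2 / (e * n%:R * K%:R) =
      6 * A / emax + 6 * A / e.
    by rewrite /A /emax; field; rewrite !gt_eqF.
  have quot_ge0 x : 0 < x -> 0 <= 6 * A / x.
    by move=> x0; apply: divr_ge0; [exact: mulr_ge0 | exact: ltW].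
  rewrite /e'; have [_|_] := leP e emax.
    by rewrite lerDr quot_ge0.
  by rewrite lerDl quot_ge0.
rewrite ler_wpM2r ?sqr_ge0// ler_wpM2l//.
have mono (a b : R) : 0 < a -> a <= b ->
    Num.min a (a ^+ 2 * n%:R * Lb) <= Num.min b (b ^+ 2 * n%:R * Lb).
  move=> a0 ab; rewrite le_min !ge_min ab/=; apply/orP; right.
  by rewrite !ler_pM2r// lerXn2r ?nnegrE// ltW// (lt_le_trans a0).
exact: mono.
Qed.

(** At stepsize [D ^+ 2 / (n K t)] the distance term is [6 * t]; for [t] either target rate the
    noise term is at most [51 * t], whence 57. *)
Lemma optimal_bound_rate (eta : R) : optimally_tuned n K D Lb Lh sigma eta ->
  bound eta <= 57 * (Lh * D ^+ 2 / (n%:R * K%:R) +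
    Num.min (sigma * D / Num.sqrt (n%:R * K%:R))
      ((Lb * sigma ^+ 2 * D ^+ 4 / (n%:R * K%:R ^+ 2)) `^ (1 / 3))).
Proof.
move=> opt; set H := Lh * D ^+ 2 / (n%:R * K%:R).
have H0 : 0 <= H by rewrite divr_ge0 ?mulr_ge0 ?sqr_ge0// ltW.
set s := Num.sqrt _; set t1 := sigma * D / s; set t2 := _ `^ _.
have s0 : 0 < s by rewrite sqrtr_gt0.
have s2E : s ^+ 2 = n%:R * K%:R by rewrite sqr_sqrtr// ltW.
have t10 : 0 <= t1 by rewrite divr_ge0 ?mulr_ge0// ltW.
have t20 : 0 <= t2 by exact: powR_ge0.
suff : bound eta <= 36 * H + 57 * Num.min t1 t2.
  by move=> h; apply: le_trans h _; lra.
have [sigma0|sigma_neq0] := eqVneq sigma 0.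
  have [_ _ /(_ emax emax_gt0 (lexx _))] := opt.
  rewrite -/bound => h; apply: le_trans h _.
  rewrite /bound /rr_bound sigma0 expr0n/= !mulr0 addr0.
  have -> : 6 * D ^+ 2 / (emax * n%:R * K%:R) = 36 * H.
    by rewrite /H /emax; field; rewrite !gt_eqF.
  by rewrite lerDl mulr_ge0// le_min t10 t20.
have sigma_gt0 : 0 < sigma by rewrite lt0r sigma_neq0.
(* For [D = 0] that stepsize would vanish; arbitrarily small positive stepsizes are used instead. *)
have [D0|D_neq0] := eqVneq D 0.
  have min_ge0 : 0 <= 36 * H + 57 * Num.min t1 t2.
    apply: addr_ge0; first exact: mulr_ge0.
    by apply: mulr_ge0 => //; rewrite le_min t10 t20.
  apply: le_trans min_ge0; apply/ler_addgt0Pr => e e0.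
  have c0 : 0 < 51 * sigma ^+ 2 by rewrite mulr_gt0// exprn_gt0.
  have d0 : 0 < e / (51 * sigma ^+ 2) by rewrite divr_gt0.
  apply: le_trans (optimal_bound_le opt d0) _.
  rewrite D0 expr0n/= !mulr0 !mul0r mulr0 !add0r.
  set m := Num.min _ _.
  have : m <= e / (51 * sigma ^+ 2) by rewrite ge_min lexx.
  by rewrite ler_pdivlMr// mulrCA mulrA.
have D_gt0 : 0 < D by rewrite lt0r D_neq0.
have t1_gt0 : 0 < t1 by rewrite divr_gt0// mulr_gt0.
have t2_gt0 : 0 < t2.
  by rewrite powR_gt0// divr_gt0 ?mulr_gt0 ?exprn_gt0.
have t2E : t2 ^+ 3 = Lb * sigma ^+ 2 * D ^+ 4 / (n%:R * K%:R ^+ 2).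
  rewrite -powR_mulrn// -powRrM mul1r mulVf// powRr1//.
  by rewrite divr_ge0 ?mulr_ge0 ?exprn_ge0// ltW.
have bound_t (t : R) : 0 < t ->
    51 * Num.min (D ^+ 2 / (n%:R * K%:R * t))
     ((D ^+ 2 / (n%:R * K%:R * t)) ^+ 2 * n%:R * Lb) * sigma ^+ 2 <= 51 * t ->
    bound eta <= 36 * H + 57 * t.
  move=> t0 ht; have e0 : 0 < D ^+ 2 / (n%:R * K%:R * t).
    by rewrite divr_gt0 ?exprn_gt0// mulr_gt0.
  apply: le_trans (optimal_bound_le opt e0) _.
  have -> : 6 * D ^+ 2 / (D ^+ 2 / (n%:R * K%:R * t) * n%:R * K%:R) = 6 * t.
    by field; rewrite !gt_eqF.
  by rewrite -/H; lra.
have le1 : bound eta <= 36 * H + 57 * t1.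
  apply: bound_t => //; rewrite -mulrA ler_pM2l//.
  apply: (@le_trans _ _ (D ^+ 2 / (n%:R * K%:R * t1) * sigma ^+ 2)).
    by rewrite ler_wpM2r ?sqr_ge0// ge_min lexx.
  rewrite -s2E /t1 le_eqVlt; apply/orP; left; apply/eqP.
  by field; rewrite !gt_eqF.
have le2 : bound eta <= 36 * H + 57 * t2.
  apply: bound_t => //; rewrite -mulrA ler_pM2l//.
  apply: (@le_trans _ _ ((D ^+ 2 / (n%:R * K%:R * t2)) ^+ 2 * n%:R * Lb * sigma ^+ 2)).
    by rewrite ler_wpM2r ?sqr_ge0// ge_min lexx orbT.
  rewrite le_eqVlt; apply/orP; left; apply/eqP.
  apply: (mulIf (_ : t2 ^+ 2 != 0)); first by rewrite expf_neq0 ?gt_eqF.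
  by rewrite -exprS t2E; field; rewrite !gt_eqF.
by rewrite /Num.min; case: ifP.
Qed.
End Tuning.

(** * From one-epoch estimates to the expected suboptimality *)

Section ExpectedSuboptimality.
Context {R : realType} {d n K : nat}.
Variables (f : 'I_n -> 'rV[R]_d -> R) (L : 'I_n -> R) (xs x1 : 'rV[R]_d).
Hypotheses (n_gt0 : (0 < n)%N) (K_gt0 : (0 < K)%N).
Hypothesis L_gt0 : forall i, 0 < L i.
Hypothesis f_convex : forall i, convex_function [set: convex_lmodType 'rV[R]_d] (f i).
Hypothesis f_smooth : forall i, smooth (L i) (f i).
Hypothesis xs_min : forall x, favg f xs <= favg f x.

Let G i := gradient (f i).
Let nP : 0 < n%:R :> R. Proof. by rewrite ltr0n. Qed.
Let KP : 0 < K%:R :> R. Proof. by rewrite ltr0n. Qed.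

Let f_ge i x y :
  f i x + dotv (G i x) (y - x) + sqnorm (G i y - G i x) / (2 * L i) <= f i y.
Proof. exact: smooth_convex_ge. Qed.

Let f_le i x y :
  f i y <= f i x + dotv (G i x) (y - x) + L i / 2 * sqnorm (y - x).
Proof. exact: smooth_le_quadratic. Qed.

(** Otherwise a gradient step of size [1 / Lbar] from [xs] would decrease [favg f] below its
    minimum. *)
Lemma sum_gradient_min : \sum_i G i xs = 0.
Proof.
have Lb0 : 0 < Lbar L by exact: Lbar_gt0.
set g := \sum_i G i xs; pose v := n%:R^-1 *: g.
have := favg_quadratic f_le xs (xs - (Lbar L)^-1 *: v).
have := xs_min (xs - (Lbar L)^-1 *: v).
have -> : xs - (Lbar L)^-1 *: v - xs = - ((Lbar L)^-1 *: v).
  by rewrite addrAC subrr add0r.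
rewrite -/g -/v dotvNr dotvZr sqnormN sqnormZ -/(sqnorm v).
have -> : Lbar L / 2 * ((Lbar L)^-1 ^+ 2 * sqnorm v) =
    (Lbar L)^-1 * sqnorm v / 2 by field; rewrite gt_eqF.
move=> h1 h2; have : (Lbar L)^-1 * sqnorm v <= 0 by lra.
rewrite pmulr_rle0 ?invr_gt0// => h3.
have /sqnorm_eq0/eqP : sqnorm v = 0.
  by apply/eqP; rewrite eq_le h3 sqnorm_ge0.
by rewrite scaler_eq0 invr_eq0 gt_eqF//= => /eqP.
Qed.

Lemma sigma_star_sqr :
  sigma_star f xs ^+ 2 = n%:R^-1 * \sum_i sqnorm (G i xs).
Proof.
rewrite sqr_sqrtr; last first.
  by rewrite mulr_ge0 ?invr_ge0 ?ler0n// sumr_ge0// => i _; exact: sqr_ge0.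
by congr (_ * _); apply: eq_bigr => i _; rewrite enorm_sqr.
Qed.

Let subopt x := favg f x - favg f xs.

Lemma expected_subopt_le (disp : measure_display) (T : measurableType disp)
    (P : probability T R) (pi : 'I_K -> T -> 'S_n) (eta a c : R)
    (x : T -> nat -> nat -> 'rV[R]_d) :
  random_reshuffling P pi -> 0 < eta -> 0 <= a ->
  (forall y, eta * \sum_(p : 'S_n) \sum_(i < n) subopt (epoch_iter G eta p y i) <=
    \sum_(p : 'S_n)
      (a * (sqnorm (y - xs) - sqnorm (epoch_iter G eta p y n - xs)) + c)) ->
  (forall w, shuffling_sgd f (fun=> eta) (pi ^~ w) x1 (x w)) ->
  ('E_P[fun w => (favg f (averaged_iterate n (fun _ : 'I_K => eta) (x w))
                  - favg f xs)%R]
   <= ((a * sqnorm (x1 - xs) + K%:R * c) / (eta * n%:R * K%:R))%:E)%E.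
Proof.
move=> rr eta0 a0 epoch_le traj.
(* The default [0] is never read, as the average only involves [k < K]. *)
pose y (q : {ffun 'I_K -> 'S_n}) k i := if insub k is Some o
  then epoch_iter G eta (q o) (epoch_start G eta q x1 k) i else 0.
pose phi q := favg f (averaged_iterate n (fun _ : 'I_K => eta) (y q)) - favg f xs.
have -> : (fun w => favg f (averaged_iterate n (fun _ : 'I_K => eta) (x w))
    - favg f xs) = (fun w => phi [ffun k => pi k w]).
  apply/funext => w; congr (favg f _ - _).
  apply: eq_bigr => k _; apply: eq_bigr => i _; congr (_ *: _).
  rewrite /y valK (@shuffling_sgd_trajectory _ _ _ _ G eta f
    [ffun k => pi k w] (pi ^~ w) x1)// 1?ltnW//.
  by move=> j; rewrite ffunE.
rewrite expectation_reshuffling//; last by move=> q; rewrite subr_ge0.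
rewrite lee_fin.
have tangent i u v : f i u + dotv (G i u) (v - u) <= f i v.
  exact: convex_tangent.
have sum_phi : eta * n%:R * K%:R * \sum_q phi q <=
    \sum_(q : {ffun 'I_K -> 'S_n}) (a * sqnorm (x1 - xs) + K%:R * c).
  apply: le_trans (sum_epochs_le x1 epoch_le a0).
  rewrite -!mulrA ler_pM2l// mulrA mulr_sumr; apply: ler_sum => q _.
  apply: le_trans (favg_averaged_iterate tangent (y q) (favg f xs) n_gt0 K_gt0 eta0) _.
  rewrite le_eqVlt; apply/orP; left; apply/eqP.
  by apply: eq_bigr => k _; apply: eq_bigr => i _; rewrite /y valK.
have NP : 0 < eta * n%:R * K%:R by apply: mulr_gt0 => //; exact: mulr_gt0.
rewrite ler_pdivlMr// mulrC mulrCA exprVn.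
have cardP : 0 < #|{perm 'I_n}|%:R ^+ K :> R.
  by rewrite exprn_gt0// ltr0n; apply/card_gt0P; exists 1%g.
rewrite ler_pdivrMl//; apply: le_trans sum_phi _.
by rewrite sumr_const card_ffun card_ord -natrX -[leLHS]mulr_natl.
Qed.

(** The small-step estimate is used when [4 * eta * n * Lbar <= 1], the large-step one otherwise. In
    the second case the minimum in the bound is at least [eta / 4], so the noise [15 * eta] is at
    most 60 times that minimum, within the doubled constant 102. *)
Lemma expected_subopt_rr_bound (disp : measure_display) (T : measurableType disp)
    (P : probability T R) (pi : 'I_K -> T -> 'S_n) (eta : R)
    (x : T -> nat -> nat -> 'rV[R]_d) :
  random_reshuffling P pi -> 0 < eta -> (forall i, 6 * (eta * L i) <= 1) ->
  (forall w, shuffling_sgd f (fun=> eta) (pi ^~ w) x1 (x w)) ->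
  ('E_P[fun w => (favg f (averaged_iterate n (fun _ : 'I_K => eta) (x w))
                  - favg f xs)%R]
   <= (2 * rr_bound n K (enorm (x1 - xs)) (Lbar L) (sigma_star f xs) eta)%:E)%E.
Proof.
move=> rr eta0 etaL traj.
rewrite /rr_bound enorm_sqr sigma_star_sqr.
set s2 := n%:R^-1 * _; set D2 := sqnorm _.
have s20 : 0 <= s2.
  by rewrite mulr_ge0 ?invr_ge0 ?ler0n// sumr_ge0// => i _; exact: sqnorm_ge0.
have D20 : 0 <= D2 := sqnorm_ge0 _.
have Q0 : 0 <= D2 / (eta * n%:R * K%:R).
  by apply: divr_ge0 => //; rewrite !mulr_ge0// ltW.
have QE : 6 * D2 / (eta * n%:R * K%:R) = 6 * (D2 / (eta * n%:R * K%:R)).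
  by rewrite mulrA.
have Lam : n%:R * Lbar L = \sum_i L i by rewrite /Lbar mulrA divff ?mul1r ?gt_eqF.
have [small|large] := leP (4 * (eta * \sum_i L i)) 1.
- have epoch_le y := epoch_small_step (x0 := y)
    (X := fun p i => epoch_iter G eta p y i) n_gt0 L_gt0 f_ge f_le
    sum_gradient_min eta0 (fun p => erefl) (fun p i => epoch_iterS G eta p y i) small.
  apply: le_trans (expected_subopt_le (a := 1) rr eta0 ler01 _ traj) _.
    by move=> y; under [leRHS]eq_bigr do rewrite mul1r; exact: epoch_le.
  rewrite lee_fin mul1r mulrDl -/s2 -/D2.
  have -> : K%:R * (8 * n%:R * eta ^+ 2 * (eta * n%:R * Lbar L) * s2) /
      (eta * n%:R * K%:R) = 8 * (eta ^+ 2 * n%:R * Lbar L) * s2.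
    by field; rewrite !gt_eqF.
  rewrite QE.
  have minE : Num.min eta (eta ^+ 2 * n%:R * Lbar L) = eta ^+ 2 * n%:R * Lbar L.
    apply/min_idPr; rewrite expr2 -!mulrA Lam.
    have Lam0 : 0 <= \sum_i L i by apply: sumr_ge0 => i _; exact: ltW.
    have := mulr_ge0 (ltW eta0) Lam0.
    by rewrite ger_pMr//; lra.
  have : 0 <= eta ^+ 2 * n%:R * Lbar L * s2.
    rewrite mulr_ge0// -mulrA Lam mulr_ge0 ?sqr_ge0// sumr_ge0// => i _.
    exact: ltW.
  by rewrite minE; lra.
- have epoch_le y := epoch_large_step (x0 := y)
    (X := fun p i => epoch_iter G eta p y i) n_gt0 L_gt0 f_ge sum_gradient_min eta0
    etaL (fun p => erefl) (fun p i => epoch_iterS G eta p y i).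
  apply: le_trans (expected_subopt_le rr eta0 _ epoch_le traj) _ => //.
  rewrite lee_fin mulrDl -/s2 -/D2.
  have -> : K%:R * (15 * n%:R * eta ^+ 2 * s2) / (eta * n%:R * K%:R) =
      15 * eta * s2 by field; rewrite !gt_eqF.
  rewrite QE -[3 / 2 * D2 / _]mulrA.
  have : eta / 4 <= Num.min eta (eta ^+ 2 * n%:R * Lbar L).
    rewrite le_min; apply/andP; split; first by lra.
    have := ltW large; rewrite -Lam => /(ler_wpM2l (ltW eta0)); lra.
  move=> /(ler_wpM2r s20); have := mulr_ge0 (ltW eta0) s20.
  by set m := Num.min _ _; lra.
Qed.

End ExpectedSuboptimality.

Theorem corollary1 (R : realType) :
  exists C : R, 0 < C /\
  forall (n d K : nat) (f : 'I_n -> 'rV[R]_d -> R) (L : 'I_n -> R)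
    (xstar x1 : 'rV[R]_d)
    (disp : measure_display) (T : measurableType disp) (P : probability T R)
    (pi : 'I_K -> T -> 'S_n),
  (0 < n)%N -> (0 < d)%N -> (0 < K)%N ->
  (forall i x, differentiable (f i) x) ->
  (favg f xstar)%:E = ereal_inf [set (favg f x)%:E | x in [set: 'rV[R]_d]] ->
  (forall i, convex_function [set: convex_lmodType 'rV[R]_d] (f i)) ->
  (forall i, 0 < L i /\ smooth (L i) (f i)) ->
  random_reshuffling P pi ->
  let D := enorm (x1 - xstar) in
  let sigma := sigma_star f xstar in
  (* An optimal stepsize exists except when x1 = xstar and sigma > 0: there the
     bound tends to its infimum 0 only as the stepsize tends to 0. *)
  (x1 <> xstar \/ sigma = 0 ->
    exists eta, optimally_tuned n K D (Lbar L) (Lhat L) sigma eta) /\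
  (forall eta, optimally_tuned n K D (Lbar L) (Lhat L) sigma eta ->
    forall x : T -> nat -> nat -> 'rV[R]_d,
    (forall w, shuffling_sgd f (fun=> eta) (pi ^~ w) x1 (x w)) ->
    ('E_P[fun w => (favg f (averaged_iterate n (fun _ : 'I_K => eta) (x w))
                    - favg f xstar)%R]
     <= (C * (Lhat L * D ^+ 2 / (n%:R * K%:R) +
              Num.min (sigma * D / Num.sqrt (n%:R * K%:R))
                      ((Lbar L * sigma ^+ 2 * D ^+ 4 / (n%:R * K%:R ^+ 2))
                         `^ (1 / 3))))%:E)%E).
Proof.
(* The constant is 2 from [expected_subopt_rr_bound] times 57 from [optimal_bound_rate]. *)
exists 114; split=> // n d K f L xs x1 disp T P pi n_gt0 _ K_gt0 _ xs_inf
  f_convex L_smooth rr D sigma.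
have L_gt0 i : 0 < L i by have [] := L_smooth i.
have f_smooth i : smooth (L i) (f i) by have [] := L_smooth i.
have xs_min x : favg f xs <= favg f x.
  by rewrite -lee_fin xs_inf; apply: ereal_inf_lbound; exists x.
have Lb_gt0 : 0 < Lbar L by exact: Lbar_gt0.
have L_le i : L i <= Lhat L by exact: le_bigmax.
have Lh_gt0 : 0 < Lhat L by exact: lt_le_trans (L_gt0 (Ordinal n_gt0)) (L_le _).
have D_ge0 : 0 <= D by exact: enorm_ge0.
have sigma_ge0 : 0 <= sigma by exact: sqrtr_ge0.
split=> [hD|eta tuned x traj].
  apply: exists_optimally_tuned => //; case: hD => [x1_neq|->]; [left|by right].
  rewrite lt0r D_ge0 andbT; apply/eqP => D0; apply: x1_neq.
  apply/subr0_eq/sqnorm_eq0; rewrite -enorm_sqr -/D D0 expr0n.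
  by [].
have [eta_gt0 eta_le _] := tuned.
have etaL i : 6 * (eta * L i) <= 1.
  move: eta_le; rewrite ler_pdivlMr ?mulr_gt0// => h.
  apply: le_trans h; rewrite mulrCA ler_pM2l// ler_pM2l//.
apply: le_trans (expected_subopt_rr_bound n_gt0 K_gt0 L_gt0 f_convex f_smooth
  xs_min rr eta_gt0 etaL traj) _.
rewrite lee_fin.
have := optimal_bound_rate n_gt0 K_gt0 Lb_gt0 Lh_gt0 D_ge0 sigma_ge0 tuned.
by rewrite -/D -/sigma; lra.
Qed.
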